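(* Let $\mathbf{M}=(E,\mathcal{P})$ be a g-matroid, $g\colon\mathcal{P}\to\mathbb{R}$ an M$^\natural$-convex function, and $E=E_1\cup\dots\cup E_m$ a partition with associated lexicographic function $\eta\colon\mathcal{P}\to\mathbb{Z}^m$, $\eta(X)_i=|E_i\cap X|$. Let $P$ be the number of Pareto optimal values of the biobjective problem of minimizing $(g(X),\eta(X))$ over $X\in\mathcal{P}$, where the first objective is ordered by $\le$ on $\mathbb{R}$ and the second by the lexicographic order $\le_{\mathrm{lex}}$ on $\mathbb{R}^m$. Then all the Pareto optimal values of this problem can be enumerated in $O(m\,P\,T_{\mathrm{VMI}})$ time, where $T_{\mathrm{VMI}}$ denotes the time for solving a valuated matroid intersection problem. Moreover, if $r$ denotes the largest cardinality of a set in $\mathcal{P}$, then $P\le\binom{r+m}{m}$, which is $O(r^m)$ for fixed $m$; in particular, for $m$ a fixed constant the enumeration takes polynomial time.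
   Context: A pair $(E,\mathcal{P})$, with $E$ finite and $\mathcal{P}$ a nonempty family of subsets of $E$, is a g-matroid if for any $P_1,P_2\in\mathcal{P}$ and $v\in P_1\setminus P_2$, either (i) $P_1\setminus\{v\}\in\mathcal{P}$ and $P_2\cup\{v\}\in\mathcal{P}$, or (ii) there is $u\in P_2\setminus P_1$ with $(P_1\setminus\{v\})\cup\{u\}\in\mathcal{P}$ and $(P_2\cup\{v\})\setminus\{u\}\in\mathcal{P}$. A function $g\colon\mathcal{P}\to\mathbb{R}$ is M$^\natural$-convex if, after setting $g(X)=+\infty$ for $X\notin\mathcal{P}$, for all $X,Y\in\mathcal{P}$ and $u\in X\setminus Y$, either $g(X)+g(Y)\ge g(X\setminus\{u\})+g(Y\cup\{u\})$, or there is $v\in Y\setminus X$ with $g(X)+g(Y)\ge g((X\setminus\{u\})\cup\{v\})+g((Y\cup\{u\})\setminus\{v\})$. The function $g$ is given by an evaluation oracle, together with an initial member of $\mathcal{P}$. Lexicographic order on $\mathbb{R}^m$: $x\le_{\mathrm{lex}}y$ iff $x=y$ or there is $k$ with $x_k<y_k$ and $x_i=y_i$ for all $i<k$. $X^*\in\mathcal{P}$ is Pareto optimal if there is no $X\in\mathcal{P}$ with $g(X)\le g(X^* )$, $\eta(X)\le_{\mathrm{lex}}\eta(X^* )$ and $(g(X),\eta(X))\ne(g(X^* ),\eta(X^* ))$. A Pareto optimal value is a pair $(g(X^* ),\eta(X^* ))$ with $X^*$ Pareto optimal. The valuated matroid intersection problem: given two functions $\omega_1,\omega_2\colon 2^F\to\mathbb{R}\cup\{+\infty\}$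 on the subsets of a finite set $F$ (with $|F|=O(|E|)$ here), each of whose effective domains is the base family of a matroid and each satisfying the exchange axiom that for all $X,Y\in\operatorname{dom}\omega_i$ and $u\in X\setminus Y$ there is $v\in Y\setminus X$ with $\omega_i(X)+\omega_i(Y)\ge\omega_i((X\setminus\{u\})\cup\{v\})+\omega_i((Y\cup\{u\})\setminus\{v\})$, find $X$ minimizing $\omega_1(X)+\omega_2(X)$ or determine that $\operatorname{dom}\omega_1\cap\operatorname{dom}\omega_2=\varnothing$. It is a known result that this problem is solvable in strongly polynomial time. $T_{\mathrm{VMI}}$ is understood to also bound the time for weighted matroid intersection on such ground sets. *)

(* Defs.v *)
(* The reals are an arbitrary R : realType. *)
From HB Require Import structures.
From mathcomp Require Import all_boot all_order all_algebra.
From mathcomp Require Import reals constructive_ereal.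

Set Implicit Arguments.
Unset Strict Implicit.
Unset Printing Implicit Defensive.

Import Order.TTheory GRing.Theory Num.Theory.

Local Open Scope ring_scope.

Definition g_matroid (E : finType) (P : {set {set E}}) : Prop :=
  P != set0 /\
  forall P1 P2 v, P1 \in P -> P2 \in P -> v \in P1 :\: P2 ->
    (P1 :\ v \in P /\ v |: P2 \in P) \/
    exists2 u, u \in P2 :\: P1 &
      u |: (P1 :\ v) \in P /\ (v |: P2) :\ u \in P.

(* A function g : P -> R is a total function on {set E} of which only the
   values on P are ever used: everything goes through [extend P g]. *)
Definition extend (R : realType) (E : finType) (P : {set {set E}})
    (g : {set E} -> R) (X : {set E}) : \bar R :=
  if X \in P then (g X)%:E else +oo%E.

Definition Mnat_convex (R : realType) (E : finType) (P : {set {set E}})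
    (g : {set E} -> R) : Prop :=
  let f := extend P g in
  forall X Y u, X \in P -> Y \in P -> u \in X :\: Y ->
    (f (X :\ u) + f (u |: Y) <= f X + f Y)%E \/
    exists2 v, v \in Y :\: X &
      (f (v |: (X :\ u)) + f ((u |: Y) :\ v) <= f X + f Y)%E.

Definition matroid_base_family (F : finType) (B : {set {set F}}) : Prop :=
  B != set0 /\
  forall X Y u, X \in B -> Y \in B -> u \in X :\: Y ->
    exists2 v, v \in Y :\: X & v |: (X :\ u) \in B.

Definition dom (R : realType) (F : finType) (w : {set F} -> \bar R) :
    {set {set F}} :=
  [set X | (w X < +oo)%E].

Definition valuated_matroid (R : realType) (F : finType)
    (w : {set F} -> \bar R) : Prop :=
  [/\ forall X, w X != -oo%E,
      matroid_base_family (dom w) &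
      forall X Y u, X \in dom w -> Y \in dom w -> u \in X :\: Y ->
        exists2 v, v \in Y :\: X &
          (w (v |: (X :\ u)) + w ((u |: Y) :\ v) <= w X + w Y)%E].

(* Parts are allowed to be empty. *)
Definition partition_into (m : nat) (E : finType) (Ei : 'I_m -> {set E}) : Prop :=
  \bigcup_i Ei i = [set: E] /\ forall i j, i != j -> [disjoint Ei i & Ei j].

Definition eta (m : nat) (E : finType) (Ei : 'I_m -> {set E}) (X : {set E}) :
    {ffun 'I_m -> int} :=
  [ffun i => #|Ei i :&: X|%:Z].

Definition le_lex (T : realDomainType) (m : nat) (x y : {ffun 'I_m -> T}) : bool :=
  (x == y) ||
  [exists k : 'I_m, (x k < y k) && [forall i : 'I_m, (i < k)%N ==> (x i == y i)]].

Definition value (R : realType) (m : nat) (E : finType) (g : {set E} -> R)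
    (Ei : 'I_m -> {set E}) (X : {set E}) : R * {ffun 'I_m -> int} :=
  (g X, eta Ei X).

Definition pareto_optimal (R : realType) (m : nat) (E : finType)
    (P : {set {set E}}) (g : {set E} -> R) (Ei : 'I_m -> {set E})
    (X : {set E}) : bool :=
  (X \in P) &&
  ~~ [exists Y in P, [&& g Y <= g X, le_lex (eta Ei Y) (eta Ei X)
                       & value g Ei Y != value g Ei X]].

Definition pareto_values (R : realType) (m : nat) (E : finType)
    (P : {set {set E}}) (g : {set E} -> R) (Ei : 'I_m -> {set E}) :
    seq (R * {ffun 'I_m -> int}) :=
  undup [seq value g Ei X | X in pareto_optimal P g Ei].

Definition num_pareto_values (R : realType) (m : nat) (E : finType)
    (P : {set {set E}}) (g : {set E} -> R) (Ei : 'I_m -> {set E}) : nat :=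
  size (pareto_values P g Ei).

Definition largest_card (E : finType) (P : {set {set E}}) : nat :=
  (\max_(X in P) #|X|)%N.

(* The memory consists of infinitely many arrays, each infinite, of naturals
   and of reals; [nmem s a i] is cell i of array a, and a program mentions
   finitely many arrays, by name.  A scalar variable is cell 0 of an array.
   Naturals support constants, addition and truncated subtraction only: with
   multiplication, unit-cost steps would be too powerful. *)
Record state (R : realType) : Type :=
  State { nmem : nat -> nat -> nat; rmem : nat -> nat -> R }.

Inductive nexp : Type :=
| NConst of nat
| NCell of nat & nexp
| NAdd of nexp & nexp
| NSub of nexp & nexp.

Inductive rexp : Type :=
| ROfNat of nexp
| RCell of nat & nexp
| RAdd of rexp & rexp
| RSub of rexp & rexp
| RMul of rexp & rexp
| RDiv of rexp & rexp.

Inductive test : Type :=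
| TLeN of nexp & nexp
| TLeR of rexp & rexp
| TNot of test.

(* [Query q a y z]: ask oracle number q for its value at the set stored in
   array a of naturals; the value goes to cell 0 of array y of reals, and cell 0
   of array z of naturals receives 1 if the value is finite and 0 otherwise. *)
Inductive cmd : Type :=
| Skip
| SetN (a : nat) (i e : nexp)
| SetR (a : nat) (i : nexp) (e : rexp)
| Seq (c1 c2 : cmd)
| If (b : test) (c1 c2 : cmd)
| While (b : test) (c : cmd)
| Query (q a y z : nat).

Definition update (T : Type) (f : nat -> nat -> T) (a i : nat) (v : T) :
    nat -> nat -> T :=
  fun a' i' => if (a' == a) && (i' == i) then v else f a' i'.

Section Semantics.

Variable R : realType.

Implicit Type s : state R.

Fixpoint neval s (e : nexp) : nat :=
  match e with
  | NConst k => k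
  | NCell a i => nmem s a (neval s i)
  | NAdd e1 e2 => (neval s e1 + neval s e2)%N
  | NSub e1 e2 => (neval s e1 - neval s e2)%N
  end.

Fixpoint reval s (e : rexp) : R :=
  match e with
  | ROfNat e => (neval s e)%:R
  | RCell a i => rmem s a (neval s i)
  | RAdd e1 e2 => reval s e1 + reval s e2
  | RSub e1 e2 => reval s e1 - reval s e2
  | RMul e1 e2 => reval s e1 * reval s e2
  | RDiv e1 e2 => reval s e1 / reval s e2
  end.

Fixpoint teval s (b : test) : bool :=
  match b with
  | TLeN e1 e2 => (neval s e1 <= neval s e2)%N
  | TLeR e1 e2 => reval s e1 <= reval s e2
  | TNot b => ~~ teval s b
  end.

Definition setn s (a i v : nat) : state R := State (update (nmem s) a i v) (rmem s).

Definition setr s (a i : nat) (v : R) : state R :=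
  State (nmem s) (update (rmem s) a i v).

(* A finite set F is known to programs as {0, ..., #|F| - 1}, through
   [enum_rank]; an array represents the set of its nonzero positions. *)
Definition array_set (F : finType) (a : nat -> nat) : {set F} :=
  [set e : F | a (enum_rank e) != 0%N].

(* [exec F ask c s s' t]: started in s, command c terminates in s' after time t,
   where [ask q] is oracle number q.  Elementary commands and tests take unit
   time, the expressions in a program being of constant size; a query takes time
   #|F| + 1, accounting for the transmission of the queried set. *)
Inductive exec (F : finType) (ask : nat -> {set F} -> \bar R) :
    cmd -> state R -> state R -> nat -> Prop :=
| ExecSkip s :
    exec ask Skip s s 1
| ExecSetN a i e s :
    exec ask (SetN a i e) s (setn s a (neval s i) (neval s e)) 1
| ExecSetR a i e s :
    exec ask (SetR a i e) s (setr s a (neval s i) (reval s e)) 1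
| ExecSeq c1 c2 s s1 s2 t1 t2 :
    exec ask c1 s s1 t1 -> exec ask c2 s1 s2 t2 ->
    exec ask (Seq c1 c2) s s2 (t1 + t2)
| ExecIf b c1 c2 s s' t :
    exec ask (if teval s b then c1 else c2) s s' t ->
    exec ask (If b c1 c2) s s' t.+1
| ExecWhileStop b c s :
    ~~ teval s b -> exec ask (While b c) s s 1
| ExecWhileStep b c s s1 s2 t1 t2 :
    teval s b -> exec ask c s s1 t1 -> exec ask (While b c) s1 s2 t2 ->
    exec ask (While b c) s s2 (t1 + t2).+1
| ExecQuery q a y z s :
    let v := ask q (array_set F (nmem s a)) in
    exec ask (Query q a y z) s
      (setn (setr s y 0 (fine v)) z 0 (v \is a fin_num)) #|F|.+1.

(* In both problems below, only the input cells of the initial memory are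
   prescribed: all others hold arbitrary values. *)

(* Valuated matroid intersection.
   Input: natural arrays 0 (|F| in cell 0), 1 and 2 (members of the two
   effective domains); oracle 0 evaluates w1 and the others evaluate w2.
   Output: natural arrays 3 (in cell 0, zero iff the effective domains are
   disjoint) and 4 (an optimal set). *)
Definition vmi_oracle (F : finType) (w1 w2 : {set F} -> \bar R) (q : nat) :
    {set F} -> \bar R :=
  if q == 0%N then w1 else w2.

Definition vmi_input (F : finType) (w1 w2 : {set F} -> \bar R) s : Prop :=
  [/\ nmem s 0 0 = #|F|, array_set F (nmem s 1) \in dom w1
    & array_set F (nmem s 2) \in dom w2].

Definition vmi_output (F : finType) (w1 w2 : {set F} -> \bar R) s : Prop :=
  let X := array_set F (nmem s 4) in
  (nmem s 3 0 = 0%N /\ dom w1 :&: dom w2 = set0) \/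
  [/\ nmem s 3 0 <> 0%N, X \in dom w1 :&: dom w2
    & forall Y : {set F}, (w1 X + w2 X <= w1 Y + w2 Y)%E].

(* [T n] bounds the time on all ground sets of at most n elements. *)
Definition solves_VMI (vmi : cmd) (T : nat -> nat) : Prop :=
  forall (n : nat) (F : finType) (w1 w2 : {set F} -> \bar R) s,
    (#|F| <= n)%N -> valuated_matroid w1 -> valuated_matroid w2 ->
    vmi_input w1 w2 s ->
    exists s' t, [/\ exec (vmi_oracle w1 w2) vmi s s' t, (t <= T n)%N
                   & vmi_output w1 w2 s'].

(* Pareto enumeration.
   Input: natural arrays 0 (|E| in cell 0), 1 (m in cell 0), 2 (the index of the
   part of each element) and 3 (a member of P); all oracles evaluate g.
   Output: the number N of listed pairs (cell 0 of natural array 4), their first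
   components (cells j < N of real array 0) and their second components (cells
   j * m + i of natural array 5). *)
Definition enum_input (m : nat) (E : finType) (P : {set {set E}})
    (Ei : 'I_m -> {set E}) s : Prop :=
  [/\ nmem s 0 0 = #|E|, nmem s 1 0 = m,
      forall i e, e \in Ei i -> nmem s 2 (enum_rank e) = i
    & array_set E (nmem s 3) \in P].

Definition enum_output (m : nat) s : seq (R * {ffun 'I_m -> int}) :=
  [seq (rmem s 0 j, [ffun i : 'I_m => (nmem s 5 (j * m + i))%:Z])
     | j <- iota 0 (nmem s 4 0)].

(* [enumerates enum P g Ei b]: within time b, program enum lists every Pareto
   optimal value exactly once. *)
Definition enumerates (enum : cmd) (m : nat) (E : finType) (P : {set {set E}})
    (g : {set E} -> R) (Ei : 'I_m -> {set E}) (b : nat) : Prop :=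
  forall s, enum_input P Ei s ->
    exists s' t, [/\ exec (fun _ => extend P g) enum s s' t, (t <= b)%N
                   & perm_eq (enum_output m s') (pareto_values P g Ei)].

End Semantics.

Definition polynomially_bounded (T : nat -> nat) : Prop :=
  exists d : nat, forall n : nat, (T n <= d * n.+1 ^ d)%N.

(* Main.v *)
Require Import Defs.
From mathcomp Require Import all_boot all_order all_algebra.
From mathcomp Require Import reals constructive_ereal.
From mathcomp Require Import zify lra.

(** Let S_k(a) be the family of the X in P with eta_i(X) = a_i for i < k and
    eta_k(X) < a_k.  The sets of P lexicographically below a are the disjoint
    union of S_0(a), ..., S_(m-1)(a) ([below], [in_cut]), and minimizing over one
    S_k(a) a function g + eps w, with w modular, is a valuated matroid
    intersection problem on a ground set of 2|E| slots: an X in P is padded with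
    |E| - |X| dummies, so that all sets have size |E|.  On one side the padding
    turns an M-natural-convex function into a valuated matroid
    ([valuated_lift]), which rests on the stronger exchange property
    [exchange_augment]; on the other side the conditions defining S_k(a) become
    a family of bases ([lex_cut_exchange]).

    The Pareto optimal values are listed by increasing g, that is, by
    decreasing eta.  If a is the last listed eta, the next value has the
    smallest g below a, obtained from m intersection problems, and among the
    minimizers the lexicographically smallest eta.  Since the intersection
    algorithm only returns some optimal set, this tie cannot be broken directly.
    Let f be the smallest g below a, attained first in S_k(a), and let B > f be a
    lower bound of g on S_j(a) for j < k.  Minimize g + eps w over S_k(a), where
    w is the positional weight (base |E| + 1) that realizes the lexicographic
    order and eps = (B - f) / (|E| + 1)^m.  The solution X need not satisfy
    g(X) = f, but g(X) < B, and hence X is Pareto optimal ([tilted_pareto]).  So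
    X is pushed on a stack of Pareto optimal sets awaiting their turn, and the
    scan is repeated, with g of the top of the stack as a further candidate for
    f and as a further bound for B.  When the top attains the minimum, it is the
    next value and is popped.  Each Pareto optimal value is pushed once and
    popped once, so there are at most 2 P + 1 scans of at most m + 1 problems
    each ([progress], [run_iteration]).

    The intersection algorithm is run inside the enumeration with its arrays
    renamed and each of its queries replaced by O(|E|) steps and at most one
    query to g ([compile_correct]); a query costs the original algorithm
    2|E| + 1, so this loses a constant factor only.  The preparation of a call
    takes O(|E|) and the rest of a scan O(m (|E| + 1)); both are paid by the
    calls, because every correct algorithm needs more than 2|E| steps in the
    worst case: without a query its answer cannot depend on the weights
    ([vmi_time_lower_bound]).

    Finally, distinct Pareto optimal values have distinct eta, a vector of m
    naturals of sum at most r, and there are 'C(r + m, m) such vectors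
    ([num_pareto_bound]). *)

Set Implicit Arguments.
Unset Strict Implicit.
Unset Printing Implicit Defensive.

Import Order.TTheory GRing.Theory Num.Theory.
Local Open Scope ring_scope.

(** * Exchange properties of M-natural-convex functions *)

Section RealExchange.
Variables (R : realType) (E : finType).
Implicit Types (P : {set {set E}}) (g : {set E} -> R) (X Y A : {set E}).

(** Being stated over the reals, with membership in P explicit, the axiom needs no
    arithmetic with infinite values. *)
Definition exchange P g : Prop :=
  forall X Y u, X \in P -> Y \in P -> u \in X :\: Y ->
    [/\ X :\ u \in P, u |: Y \in P & g (X :\ u) + g (u |: Y) <= g X + g Y] \/
    exists2 v, v \in Y :\: X &
      [/\ v |: (X :\ u) \in P, (u |: Y) :\ v \in P
        & g (v |: (X :\ u)) + g ((u |: Y) :\ v) <= g X + g Y].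

Lemma extend_add_le P g X Y X' Y' : X \in P -> Y \in P ->
  (extend P g X' + extend P g Y' <= extend P g X + extend P g Y)%E ->
  [/\ X' \in P, Y' \in P & g X' + g Y' <= g X + g Y].
Proof.
rewrite /extend => -> ->; case: (X' \in P); case: (Y' \in P) => //=.
Qed.

Lemma Mnat_exchange P g : Mnat_convex P g -> exchange P g.
Proof.
move=> H X Y u XP YP uXY; case: (H X Y u XP YP uXY) => [le|[v vYX le]].
  by left; apply: extend_add_le le.
by right; exists v => //; apply: extend_add_le le.
Qed.

(** Adding a modular function preserves all exchange inequalities, because the two
    sides cover the same elements with the same multiplicities. *)
Definition tilt g (p : E -> R) X : R := g X + \sum_(x in X) p x.

Lemma tiltU1 g p x X : x \notin X -> tilt g p (x |: X) = g (x |: X) + p x + \sum_(y in X) p y.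
Proof. by move=> xX; rewrite /tilt big_setU1 //= addrA. Qed.

Lemma tiltD1 g p x X : x \in X -> tilt g p (X :\ x) = g (X :\ x) - p x + \sum_(y in X) p y.
Proof. by move=> xX; rewrite /tilt [in RHS](big_setD1 x) //= addrA subrK. Qed.

Lemma setD1C (x y : E) X : x != y -> x |: (X :\ y) = (x |: X) :\ y.
Proof.
by move=> xy; apply/setP => z; rewrite !inE; case: (eqVneq z x) => [->|]; rewrite ?xy.
Qed.

Lemma exchange_tilt P g p : exchange P g -> exchange P (tilt g p).
Proof.
move=> H X Y u XP YP uXY; have /setDP[uX uY] := uXY.
case: (H X Y u XP YP uXY) => [[a b le]|[v vYX [a b le]]].
  left; split=> //; rewrite tiltD1 // tiltU1 // /tilt; lra.
have /setDP[vY vX] := vYX.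
have uv : v != u by apply: contraNneq vX => ->.
right; exists v => //; split => //.
rewrite setD1C // in a le *.
rewrite (tiltD1 _ _ (_ : u \in v |: X)) ?(tiltD1 _ _ (_ : v \in u |: Y)) ?inE ?uX ?vY ?orbT //.
rewrite !big_setU1 //= /tilt; lra.
Qed.

(** The axiom compensates the move of an element of A from Y to X by an element of
    X minus Y, or not at all.  When A outnumbers X minus Y, some v in A can move
    without compensation.  Induction on |X minus Y|.  In a counterexample, tilting g
    to h makes all X + v (v in A) as good as X while all Y - v are worse than Y.  Fix u
    in X minus Y for which some X + v - u is in P, choose v0 minimizing X + v0 - u
    and apply the induction hypothesis to this set and Y: it gives v1 with
    h(X + v0 + v1 - u) < h(X + v0 - u).  The exchanges between X and the latter
    set, together with the minimality of v0, are contradictory. *)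
Lemma exchange_augment P g X Y A :
  exchange P g -> X \in P -> Y \in P -> A \subset Y :\: X ->
  (#|X :\: Y| < #|A|)%N ->
  exists2 v, v \in A &
    [/\ v |: X \in P, Y :\ v \in P & g (v |: X) + g (Y :\ v) <= g X + g Y].
Proof.
move: {2}#|_| (erefl #|X :\: Y|) => k; elim: k g X A => [|k IH] g X A cXY exg XP YP AYX ltA.
  have /card_gt0P[v vA] : (0 < #|A|)%N by apply: leq_trans ltA.
  case: (exg Y X v YP XP (subsetP AYX _ vA)) => [[a b le]|[u uXY _]].
    by exists v => //; split => //; lra.
  by move/eqP: cXY; rewrite cards_eq0 => /eqP e; rewrite e inE in uXY.
have inA v : v \in A -> (v \in Y) /\ (v \notin X).
  by move=> vA; have /setDP := subsetP AYX _ vA.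
have [/existsP[v /and4P[vA a b le]]|nex] :=
  boolP [exists v, [&& v \in A, v |: X \in P, Y :\ v \in P &
     g (v |: X) + g (Y :\ v) <= g X + g Y]]; first by exists v.
exfalso.
have H v : v \in A -> v |: X \in P -> Y :\ v \in P ->
    g X + g Y < g (v |: X) + g (Y :\ v).
  move=> vA a b; rewrite ltNge; apply: contra nex => le.
  by apply/existsP; exists v; rewrite vA a b le.
(* When v |: X is not in P, any p v making Y :\ v worse than Y will do. *)
pose p v := if v |: X \in P then g X - g (v |: X) else g (Y :\ v) - g Y - 1.
pose h := tilt g p.
have exh : exchange P h by apply: exchange_tilt.
have hX v : v \in A -> v |: X \in P -> h (v |: X) = h X.
  move=> vA vX; have [_ nX] := inA v vA.
  by rewrite /h tiltU1 // /tilt /p vX; lra.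
have hY v : v \in A -> Y :\ v \in P -> h Y < h (Y :\ v).
  move=> vA vY; have [iY _] := inA v vA.
  rewrite /h tiltD1 // /tilt /p; case: ifP => [vX|_]; last by lra.
  by have := H v vA vX vY; lra.
have /card_gt0P[v vA] : (0 < #|A|)%N by apply: leq_trans ltA.
case: (exg Y X v YP XP (subsetP AYX _ vA)) => [[a b le]|[u uXY [_ vP _]]].
  by have := H v vA b a; lra.
have /setDP[uX uY] := uXY.
pose Q w := (w \in A) && ((w |: X) :\ u \in P).
have Qv : Q v by rewrite /Q vA vP.
case: (@arg_minP _ R E v Q (fun w => h ((w |: X) :\ u)) Qv) => v0 /andP[v0A X1P] minv0.
set X1 := (v0 |: X) :\ u in X1P minv0 *.
have [v0Y v0X] := inA _ v0A.
have v0u : v0 != u by apply: contraNneq v0X => ->.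
have eX1 : X1 :\: Y = (X :\: Y) :\ u.
  by apply/setP => z; rewrite !inE; case: (eqVneq z v0) => [->|_] /=; rewrite ?v0Y ?andbF // andbCA.
have cX1 : #|X1 :\: Y| = k.
  by apply/eqP; rewrite eX1 -eqSS -cXY (cardsD1 u (X :\: Y)) uXY.
have A1 : A :\ v0 \subset Y :\: X1.
  apply/subsetP => z; rewrite !inE => /andP[zv zA]; have [zY zX] := inA _ zA.
  by rewrite zY andbT (negbTE zv) (negbTE zX) /= andbF.
have [|v1 v1A [aP bP le1]] := IH h X1 (A :\ v0) cX1 exh X1P YP A1.
  by move: ltA; rewrite cX1 cXY (cardsD1 v0 A) v0A.
have {}v1A : (v1 \in A) /\ v1 != v0 by move: v1A; rewrite !inE => /andP[].
case: v1A => v1A v10; have [v1Y v1X] := inA _ v1A.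
have v1u : v1 != u by apply: contraNneq v1X => ->.
have lt1 : h (v1 |: X1) < h X1 by have := hY _ v1A bP; lra.
set Z := v1 |: X1 in aP le1 lt1.
have uXZ : u \in X :\: Z.
  by rewrite !inE eqxx (negbTE (contraNneq _ v1u)) /= ?uX // => ->.
have min1 : (v1 |: X) :\ u \in P -> h X1 <= h ((v1 |: X) :\ u).
  by move=> ?; apply: minv0; rewrite /Q v1A.
have e01 : v0 != v1 by rewrite eq_sym.
case: (exh X Z u XP aP uXZ) => [[c d le]|[w wZX [c d le]]].
  have eW : u |: Z = v0 |: (v1 |: X).
    by apply/setP => z; rewrite !inE; case: (eqVneq z u) => [->|]; rewrite ?uX ?orbT //= orbCA.
  rewrite eW in d le.
  have w0 : v0 \in (v0 |: (v1 |: X)) :\: X by rewrite !inE eqxx v0X.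
  case: (exh _ X v0 d XP w0) => [[c' d' le']|[w]]; last first.
    by rewrite !inE => /andP[+ wX]; rewrite wX !orbT.
  have ec' : (v0 |: (v1 |: X)) :\ v0 = v1 |: X.
    by apply: setU1K; rewrite !inE (negbTE v0X) (negbTE e01).
  rewrite ec' in c' le'.
  rewrite hX // hX // in le'.
  have v0Z : v0 \in Z :\: (X :\ u).
    by rewrite !inE eqxx (negbTE v0X) v0u /= !orbT.
  case: (exh Z (X :\ u) v0 aP c v0Z) => [[c2 d2 le2]|[w]]; last first.
    by rewrite !inE => /andP[+ /andP[wu wX]]; rewrite wu wX !orbT.
  have e2 : v0 |: (X :\ u) = X1 by rewrite setD1C.
  have e3 : Z :\ v0 = (v1 |: X) :\ u.
    rewrite /Z /X1 setD1C //; apply/setP => z; rewrite !inE.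
    case: (eqVneq z v0) => [->|_] /=; last by [].
    by rewrite (negbTE v0X) (negbTE e01) andbF.
  rewrite e2 e3 in c2 d2 le2; have := min1 c2; lra.
have e2 : u |: Z = v0 |: (v1 |: X).
  by apply/setP => z; rewrite !inE; case: (eqVneq z u) => [->|]; rewrite ?uX ?orbT //= orbCA.
rewrite e2 in d le.
have ow : (w == v0) || (w == v1).
  move: wZX; rewrite !inE => /andP[/negbTE wX]; rewrite wX orbF => /orP[->|/andP[_ ->]] //.
  by rewrite orbT.
case/orP: ow => /eqP ew; subst w.
  have ec' : (v0 |: (v1 |: X)) :\ v0 = v1 |: X.
    by apply: setU1K; rewrite !inE (negbTE v0X) (negbTE e01).
  rewrite setD1C // ec' in c d le; rewrite (hX v1) // in le; rewrite -/X1 in le; move: le lt1; lra.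
have ec' : (v0 |: (v1 |: X)) :\ v1 = v0 |: X.
  by rewrite setUCA; apply: setU1K; rewrite !inE (negbTE v1X) (negbTE v10).
rewrite setD1C // ec' in c d le; rewrite (hX v0) // in le.
by have := min1 c; lra.
Qed.

End RealExchange.

(** * From M-natural-convex functions to valuated matroids *)

Section Reduction.
Variables (R : realType).

(** Functions that are infinite outside a given family. *)
Definition on_family (F : finType) (B : {set {set F}}) (h : {set F} -> R)
    (Z : {set F}) : \bar R :=
  if Z \in B then (h Z)%:E else +oo%E.

Lemma dom_on_family (F : finType) (B : {set {set F}}) h : dom (on_family B h) = B.
Proof. by apply/setP => Z; rewrite inE /on_family; case: ifP => _; rewrite ?ltry. Qed.

Lemma valuated_on_family (F : finType) (B : {set {set F}}) h :
  B != set0 ->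
  (forall X Y u, X \in B -> Y \in B -> u \in X :\: Y ->
    exists2 v, v \in Y :\: X &
      [/\ v |: (X :\ u) \in B, (u |: Y) :\ v \in B
        & h (v |: (X :\ u)) + h ((u |: Y) :\ v) <= h X + h Y]) ->
  valuated_matroid (on_family B h).
Proof.
move=> B0 exB; split.
- by move=> X; rewrite /on_family; case: ifP.
- rewrite dom_on_family; split=> // X Y u XB YB uXY.
  by have [v vYX [? _ _]] := exB X Y u XB YB uXY; exists v.
- rewrite dom_on_family => X Y u XB YB uXY.
  have [v vYX [a b le]] := exB X Y u XB YB uXY; exists v => //.
  by rewrite /on_family a b XB YB -!EFinD lee_fin.
Qed.

Variable E : finType.
Let n := #|E|.
Implicit Types (P : {set {set E}}) (X Y Z : {set 'I_(n + n)}) (e : E) (j : 'I_n).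

(** The ground set of the intersection problems has a slot for each element of E,
    placed where [enum_rank] puts it, followed by |E| dummy slots. *)
Definition elt e : 'I_(n + n) := lshift n (enum_rank e).
Definition dummy j : 'I_(n + n) := rshift n j.
Definition proj Z : {set E} := [set e | elt e \in Z].
Definition dummies Z : {set 'I_n} := [set j | dummy j \in Z].

Variant slot_spec : 'I_(n + n) -> Prop :=
| SlotElt e : slot_spec (elt e)
| SlotDummy j : slot_spec (dummy j).

Lemma slotP u : slot_spec u.
Proof.
by case: (split_ordP u) => j ->; [rewrite -(enum_valK j)|]; constructor.
Qed.

Lemma elt_inj : injective elt.
Proof. by move=> e f /lshift_inj /enum_rank_inj. Qed.

Lemma elt_dummy e j : (elt e == dummy j) = false.
Proof. exact: eq_lrshift. Qed.

Lemma dummy_elt e j : (dummy j == elt e) = false.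
Proof. exact: eq_rlshift. Qed.

Lemma elt_eq e f : (elt e == elt f) = (e == f).
Proof. by apply/eqP/eqP => [/elt_inj|->]. Qed.

Lemma dummy_eq i j : (dummy i == dummy j) = (i == j).
Proof. exact: eq_rshift. Qed.

Definition slotE := (elt_dummy, dummy_elt, elt_eq, dummy_eq).

Lemma card_slots Z : #|Z| = (#|proj Z| + #|dummies Z|)%N.
Proof.
have defZ : Z = [set elt e | e in proj Z] :|: [set dummy j | j in dummies Z].
  apply/setP => u; rewrite inE; case: (slotP u) => [e|j].
    rewrite mem_imset; last exact: elt_inj.
    rewrite inE; case: (boolP (elt e \in Z)) => //= _.
    by apply/esym/negbTE/imsetP => -[j _ /eqP]; rewrite slotE.
  rewrite orbC mem_imset; last exact: rshift_inj.
  rewrite inE; case: (boolP (dummy j \in Z)) => //= _.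
  by apply/esym/negbTE/imsetP => -[e _ /eqP]; rewrite slotE.
rewrite [in LHS]defZ cardsU disjoint_setI0 ?cards0 ?subn0; last first.
  rewrite -setI_eq0; apply/eqP/setP => u; rewrite !inE.
  by apply/negbTE/andP => -[/imsetP[e _ ->] /imsetP[j _ /eqP]]; rewrite slotE.
by rewrite !card_imset; [|exact: rshift_inj|exact: elt_inj].
Qed.

Definition lift_family (P : {set {set E}}) : {set {set 'I_(n + n)}} :=
  [set Z : {set 'I_(n + n)} | (#|Z| == n) && (proj Z \in P)].

Lemma card_swap (F : finType) (X Y : {set F}) u v : u \in X :\: Y -> v \in Y :\: X ->
  #|v |: (X :\ u)| = #|X| /\ #|(u |: Y) :\ v| = #|Y|.
Proof.
rewrite !inE => /andP[uY uX] /andP[vX vY]; split.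
  by rewrite cardsU1 !inE (negbTE vX) andbF /= (cardsD1 u X) uX.
have := cardsD1 v (u |: Y); rewrite cardsU1 uY !inE vY orbT /= !add1n.
by move=> [].
Qed.

(** An exchange that moves u without compensation is compensated by a dummy.
    Where no dummy is available, the sizes of the projections compare in the
    right direction for [exchange_augment] to provide an element instead. *)
Lemma valuated_lift P h : P != set0 -> exchange P h ->
  lift_family P != set0 ->
  valuated_matroid (on_family (lift_family P) (h \o proj)).
Proof.
move=> P0 exP B0; apply: valuated_on_family => // X Y u.
rewrite ![_ \in lift_family _]inE => /andP[/eqP cX XP] /andP[/eqP cY YP] uXY.
suff [v vYX [a b le]] : exists2 v, v \in Y :\: X &
      [/\ proj (v |: (X :\ u)) \in P, proj ((u |: Y) :\ v) \in P
        & h (proj (v |: (X :\ u))) + h (proj ((u |: Y) :\ v)) <= h (proj X) + h (proj Y)].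
  have [c1 c2] : #|v |: (X :\ u)| = #|X| /\ #|(u |: Y) :\ v| = #|Y|.
    by apply: card_swap.
  by exists v => //; rewrite !inE c1 c2 cX cY eqxx /=.
have cs Z : #|Z| = n -> (#|proj Z| + #|dummies Z|)%N = n by rewrite card_slots.
have := cs X cX; have := cs Y cY => {}cY {}cX.
have cD : (#|proj X| <= #|proj Y|)%N -> (#|proj X :\: proj Y| <= #|proj Y :\: proj X|)%N.
  by rewrite !cardsD setIC; apply: leq_sub2r.
move: uXY; case: (slotP u) => [e|d] /setDP[uX uY].
  have eXY : e \in proj X :\: proj Y by rewrite !inE uX uY.
  case: (exP _ _ e XP YP eXY) => [[a b le]|[f /setDP[fY fX] [a b le]]]; last first.
    have e1 : proj (elt f |: (X :\ elt e)) = f |: (proj X :\ e).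
      by apply/setP => x; rewrite !inE !slotE.
    have e2 : proj ((elt e |: Y) :\ elt f) = (e |: proj Y) :\ f.
      by apply/setP => x; rewrite !inE !slotE.
    by exists (elt f); rewrite ?e1 ?e2 // inE; move: fX fY; rewrite !inE => -> ->.
  have [sD|] := boolP (dummies Y \subset dummies X); last first.
    case/subsetPn=> d; rewrite !inE => dY dX; exists (dummy d); rewrite ?inE ?dY ?dX //.
    have e1 : proj (dummy d |: (X :\ elt e)) = proj X :\ e.
      by apply/setP => x; rewrite !inE !slotE.
    have e2 : proj ((elt e |: Y) :\ dummy d) = e |: proj Y.
      by apply/setP => x; rewrite !inE !slotE.
    by rewrite e1 e2.
  have {}sD : (#|proj X| <= #|proj Y|)%N by have := subset_leq_card sD; lia.
  have sA : (proj Y :\: proj X) \subset (e |: proj Y) :\: (proj X :\ e).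
    by apply/subsetP => x; rewrite !inE => /andP[/negbTE-> ->]; rewrite andbF orbT.
  have [|f] := exchange_augment exP a b sA.
    have := cD sD; rewrite (cardsD1 e (proj X :\: proj Y)) eXY add1n; apply: leq_trans.
    rewrite ltnS; apply/subset_leq_card/subsetP => x; rewrite !inE negb_or => /andP[/andP[-> ->]].
    by case/andP=> _ ->.
  rewrite !inE => /andP[fX fY] [a' b' le']; exists (elt f); first by rewrite !inE fX fY.
  have e1 : proj (elt f |: (X :\ elt e)) = f |: (proj X :\ e).
    by apply/setP => x; rewrite !inE !slotE.
  have e2 : proj ((elt e |: Y) :\ elt f) = (e |: proj Y) :\ f.
    by apply/setP => x; rewrite !inE !slotE.
  by rewrite e1 e2; split => //; lra.
have [sD|] := boolP (dummies Y \subset dummies X); last first.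
  case/subsetPn=> d'; rewrite !inE => dY dX; exists (dummy d'); rewrite ?inE ?dY ?dX //.
  have e1 : proj (dummy d' |: (X :\ dummy d)) = proj X.
    by apply/setP => x; rewrite !inE !slotE.
  have e2 : proj ((dummy d |: Y) :\ dummy d') = proj Y.
    by apply/setP => x; rewrite !inE !slotE.
  by rewrite e1 e2.
have {}sD : (#|dummies Y| < #|dummies X|)%N.
  apply: proper_card; rewrite properE sD /=; apply/subsetPn; exists d; by rewrite inE.
have [|f] := exchange_augment exP XP YP (subxx _).
  have ltXY : (#|proj X| < #|proj Y|)%N by lia.
  have sub : (#|proj X :&: proj Y| <= #|proj X|)%N by apply/subset_leq_card/subsetIl.
  rewrite !cardsD [proj Y :&: _]setIC; lia.
rewrite !inE => /andP[fX fY] [a' b' le']; exists (elt f); first by rewrite !inE fX fY.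
have e1 : proj (elt f |: (X :\ dummy d)) = f |: proj X.
  by apply/setP => x; rewrite !inE !slotE.
have e2 : proj ((dummy d |: Y) :\ elt f) = proj Y :\ f.
  by apply/setP => x; rewrite !inE !slotE.
by rewrite e1 e2; split.
Qed.

End Reduction.

(** * Lexicographic cuts as families of bases *)

Section LexCut.
Variables (F : finType) (cl : F -> nat) (N k : nat) (a : nat -> nat).
Implicit Types (X Y Z : {set F}).
Local Open Scope nat_scope.

Definition level c Z : nat := #|[set z in Z | cl z == c]|.

Definition in_cut Z : bool := [forall c : 'I_k, level c Z == a c] && (level k Z < a k).

Definition lex_cut_family : {set {set F}} := [set Z : {set F} | (#|Z| == N) && in_cut Z].

Lemma in_cutP Z :
  reflect ((forall c, c < k -> level c Z = a c) /\ level k Z < a k) (in_cut Z).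
Proof.
apply: (iffP andP) => -[H kZ]; split=> //.
  by move=> c ck; have /forallP/(_ (Ordinal ck))/eqP := H.
by apply/forallP => c; apply/eqP/H.
Qed.

Lemma card_set_setU1 (p : pred F) v Z : v \notin Z ->
  #|[set z in v |: Z | p z]| = (p v + #|[set z in Z | p z]|)%N.
Proof.
move=> vZ; case: (boolP (p v)) => pv.
  have := cardsU1 v [set z in Z | p z]; rewrite inE (negbTE vZ) /= => <-.
  by congr #|pred_of_set _|; apply/setP => z; rewrite !inE; case: eqVneq => [->|].
by congr #|pred_of_set _|; apply/setP => z; rewrite !inE; case: eqVneq => [->|//]; rewrite (negbTE vZ) (negbTE pv).
Qed.

Lemma card_set_setD1 (p : pred F) v Z : v \in Z ->
  #|[set z in Z | p z]| = (p v + #|[set z in Z :\ v | p z]|)%N.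
Proof.
by move=> vZ; rewrite -{1}(setD1K vZ) card_set_setU1 // !inE eqxx.
Qed.

Lemma card_set_swap (p : pred F) X Y u v : u \in X :\: Y -> v \in Y :\: X ->
  #|[set z in v |: (X :\ u) | p z]| + p u = #|[set z in X | p z]| + p v /\
  #|[set z in (u |: Y) :\ v | p z]| + p v = #|[set z in Y | p z]| + p u.
Proof.
move=> /setDP[uX uY] /setDP[vY vX].
rewrite card_set_setU1; last by rewrite !inE (negbTE vX) andbF.
have := card_set_setD1 p uX; have := @card_set_setD1 p v (u |: Y).
rewrite !inE vY orbT => /(_ isT); rewrite card_set_setU1 //; lia.
Qed.

Lemma card_set_exchange (p : pred F) X Y :
  [forall v, (v \in Y :\: X) ==> ~~ p v] ->
  #|[set z in Y | p z]| <= #|[set z in X | p z]|.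
Proof.
move=> /forallP H; apply/subset_leq_card/subsetP => z; rewrite !inE => /andP[zY pz].
rewrite pz andbT; apply: contraLR (pz) => zX.
by have := H z; rewrite !inE zX zY.
Qed.

Lemma card_set_exchange_lt (p : pred F) X Y u : u \in X :\: Y -> p u ->
  [forall v, (v \in Y :\: X) ==> ~~ p v] ->
  #|[set z in Y | p z]| < #|[set z in X | p z]|.
Proof.
move=> /setDP[uX uY] pu /forallP H; rewrite (card_set_setD1 p uX) pu add1n ltnS.
apply/subset_leq_card/subsetP => z; rewrite !inE => /andP[zY pz].
rewrite pz andbT; apply/andP; split; first by apply: contraNneq uY => <-.
apply: contraLR (pz) => zX.
by have := H z; rewrite !inE zX zY.
Qed.

(** The levels above k are unconstrained in a lexicographic cut and count as one class. *)
Lemma sum_level Z :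
  #|Z| = \sum_(c < k) level c Z + level k Z + #|[set z in Z | k < cl z]|.
Proof.
have -> : \sum_(c < k) level c Z = #|[set z in Z | cl z < k]|.
  rewrite -sum1_card.
  rewrite (eq_bigl (fun z => (z \in Z) && (cl z < k))); last by move=> z; rewrite inE.
  case: k => [|k']; first by rewrite big_ord0 big_pred0 // => z; rewrite andbF.
  rewrite (partition_big (fun z => inord (cl z) : 'I_k'.+1) xpredT) //=.
  apply: eq_bigr => c _; rewrite /level -sum1_card; apply: eq_bigl => z.
  rewrite inE -andbA; congr (_ && _); apply/eqP/andP => [->|[h /eqP<-]].
    by rewrite ltn_ord inord_val.
  by rewrite inordK.
rewrite /level -[in LHS](cardsID [set z | cl z < k] Z).
rewrite -[X in _ + X = _](cardsID [set z | cl z == k]).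
have e1 : Z :&: [set z | cl z < k] = [set z in Z | cl z < k] by apply/setP => z; rewrite !inE.
have e2 : (Z :\: [set z | cl z < k]) :&: [set z | cl z == k] = [set z in Z | cl z == k].
  by apply/setP => z; rewrite !inE; lia.
have e3 : (Z :\: [set z | cl z < k]) :\: [set z | cl z == k] = [set z in Z | k < cl z].
  by apply/setP => z; rewrite !inE; lia.
by rewrite e1 e2 e3 addnA.
Qed.

(** All sets have the same size and the same levels below k.  So an element of these
    levels can be replaced within its level.  Moreover the sum of level k and of the levels above k is the same for X and Y, and if u cannot be
    replaced within its class, then Y exceeds X in the other of these two classes. *)
Lemma lex_cut_exchange X Y u : X \in lex_cut_family -> Y \in lex_cut_family ->
  u \in X :\: Y ->
  exists2 v, v \in Y :\: X &
     v |: (X :\ u) \in lex_cut_family /\ (u |: Y) :\ v \in lex_cut_family.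
Proof.
rewrite ![_ \in lex_cut_family]inE => /andP[/eqP cX /in_cutP[eX kX]] /andP[/eqP cY /in_cutP[eY kY]] uXY.
suff [v vYX [H1 H2 H3]] : exists2 v, v \in Y :\: X &
    [/\ forall c, c < k -> (cl u == c) = (cl v == c),
        level k X + (cl v == k) < a k + (cl u == k) &
        level k Y + (cl u == k) < a k + (cl v == k)].
  exists v => //; rewrite !inE; have [c1 c2] := card_swap uXY vYX.
  rewrite c1 c2 cX cY eqxx /=.
  have sw c := card_set_swap (fun z => cl z == c) uXY vYX.
  split; apply/in_cutP; split.
  - by move=> c ck; have [+ _] := sw c; rewrite H1 // => /addIn; rewrite -!/(level _ _) eX.
  - by have [+ _] := sw k; rewrite -!/(level _ _); lia.
  - by move=> c ck; have [_ +] := sw c; rewrite H1 // => /addIn; rewrite -!/(level _ _) eY.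
  - by have [_ +] := sw k; rewrite -!/(level _ _); lia.
have eL c : c < k -> level c X = level c Y by move=> ck; rewrite eX // eY.
have eS : level k X + #|[set z in X | k < cl z]| = level k Y + #|[set z in Y | k < cl z]|.
  have sX := sum_level X; have sY := sum_level Y.
  have e : \sum_(c < k) level c X = \sum_(c < k) level c Y by apply: eq_bigr => c _; apply: eL.
  by lia.
have search (p : pred F) : (exists2 v, v \in Y :\: X & p v) \/ [forall v, (v \in Y :\: X) ==> ~~ p v].
  have [/existsP[v /andP[? ?]]|] := boolP [exists v, (v \in Y :\: X) && p v].
    by left; exists v.
  rewrite negb_exists => /forallP H; right; apply/forallP => v; apply/implyP => vYX.
  by have := H v; rewrite vYX.
case: (ltngtP (cl u) k) => [uk|uk|uk].
- case: (search (fun z => cl z == cl u)) => [[v vYX /eqP e]|/(@card_set_exchange_lt (fun z => cl z == cl u) _ _ _ uXY (eqxx _))].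
    by exists v => //; split=> [c ck||]; rewrite e //; lia.
  by rewrite -!/(level _ _) eL // ltnn.
- case: (search (fun z => k < cl z)) => [[v vYX e]|/(@card_set_exchange_lt (fun z => k < cl z) _ _ _ uXY uk) lt].
    by exists v => //; split=> [c ck||]; lia.
  case: (search (fun z => cl z == k)) => [[v vYX /eqP e]|/card_set_exchange].
    by exists v => //; split=> [c ck||]; lia.
  by rewrite -!/(level _ _); lia.
- case: (search (fun z => cl z == k)) => [[v vYX /eqP e]|].
    by exists v => //; split=> [c ck||]; lia.
  move/eqP in uk; move=> /(@card_set_exchange_lt (fun z => cl z == k) _ _ _ uXY uk); rewrite -!/(level _ _) => lt.
  case: (search (fun z => k < cl z)) => [[v vYX e]|/card_set_exchange].
    by exists v => //; split=> [c ck||]; lia.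
  by lia.
Qed.

Lemma valuated_lex_cut (R : realType) : lex_cut_family != set0 ->
  valuated_matroid (on_family lex_cut_family (fun=> 0%R : R)).
Proof.
move=> B0; apply: valuated_on_family => // X Y u XB YB uXY.
by have [v vYX [aB bB]] := lex_cut_exchange XB YB uXY; exists v.
Qed.

End LexCut.

(** * Pareto optimal sets and the order of enumeration *)

Section Pareto.
Variables (R : realType) (m : nat) (E : finType) (P : {set {set E}}) (g : {set E} -> R).
Variables (Ei : 'I_m -> {set E}) (part : E -> 'I_m).
Hypothesis Ei_part : forall i, Ei i = [set e | part e == i].
Implicit Types (X Y Z : {set E}) (a : nat -> nat).

Local Notation cl := (fun e => part e : nat).
Local Notation lev := (level cl).
Local Notation q := (#|E|.+1).

(** The levels of X read as the digits of a number in base |E| + 1. *)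
Definition lex_weight X : nat := (\sum_(e in X) q ^ (m.-1 - part e))%N.

Lemma eta_level X i : eta Ei X i = (lev i X)%:Z.
Proof.
rewrite ffunE; congr (_%:Z); congr #|pred_of_set _|.
by apply/setP => e; rewrite Ei_part !inE andbC.
Qed.

Lemma level_card c X : (lev c X <= #|E|)%N.
Proof. exact: max_card. Qed.

Lemma lex_weight_bound X : (0 < m)%N -> (lex_weight X < q ^ m)%N.
Proof.
move=> m0; have le : (lex_weight X <= #|E| * q ^ m.-1)%N.
  apply: leq_trans (_ : (\sum_(e in X) q ^ m.-1 <= _)%N).
    by apply: leq_sum => e _; rewrite leq_pexp2l // leq_subr.
  by rewrite sum_nat_const leq_mul2r max_card orbT.
by apply: leq_ltn_trans le _; rewrite -{2}(prednK m0) expnS ltn_pmul2r // expn_gt0.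
Qed.

(** Since X has at most |E| elements, those of the levels above k weigh together
    less than a single element of level k. *)
Lemma lex_weight_lt k X Y : (k < m)%N -> (forall c, (c < k)%N -> lev c X = lev c Y) ->
  (lev k X < lev k Y)%N -> (lex_weight X < lex_weight Y)%N.
Proof.
move=> km eqXY ltXY.
have low Z : (\sum_(e in Z | (cl e < k)%N) q ^ (m.-1 - part e) =
    \sum_(c < k) lev c Z * q ^ (m.-1 - c))%N.
  case: k {km eqXY ltXY} => [|k]; first by rewrite big_ord0 big_pred0 // => e; rewrite andbF.
  rewrite (partition_big (fun e => inord (cl e) : 'I_k.+1) xpredT) //=.
  apply: eq_bigr => c _; rewrite /level -sum_nat_const; apply: eq_big => [e|e].
    rewrite inE -andbA; congr (_ && _); apply/andP/eqP => [[h /eqP<-]|->].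
      by rewrite inordK.
    by rewrite ltn_ord inord_val.
  by case/andP=> /andP[_ h] /eqP<-; rewrite inordK.
have mid Z : (\sum_(e in Z | cl e == k) q ^ (m.-1 - part e) = lev k Z * q ^ (m.-1 - k))%N.
  rewrite /level -sum_nat_const; apply: eq_big => [e|e]; first by rewrite inE.
  by case/andP=> _ /eqP->.
have split3 Z : (lex_weight Z = \sum_(c < k) lev c Z * q ^ (m.-1 - c) +
    (lev k Z * q ^ (m.-1 - k) + \sum_(e in Z | (k < cl e)%N) q ^ (m.-1 - part e)))%N.
  rewrite -low -mid /lex_weight (bigID (fun e => (cl e < k)%N)) /=; congr (_ + _)%N.
  rewrite (bigID (fun e => cl e == k)) /=; congr (_ + _)%N; apply: eq_bigl => e;
  rewrite -andbA; congr (_ && _); lia.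
have tail : (\sum_(e in X | (k < cl e)%N) q ^ (m.-1 - part e) < q ^ (m.-1 - k))%N.
  have [km1|km1] := ltnP k.+1 m; last first.
    rewrite big_pred0 ?expn_gt0 // => e; apply/negbTE.
    by rewrite negb_and -leqNgt -ltnS (leq_trans (ltn_ord _) km1) orbT.
  have -> : (m.-1 - k = (m.-1 - k.+1).+1)%N by lia.
  rewrite expnS; apply: (@leq_ltn_trans (#|E| * q ^ (m.-1 - k.+1))%N); last first.
    by rewrite ltn_pmul2r // expn_gt0.
  apply: (@leq_trans (\sum_(e in X | (k < cl e)%N) q ^ (m.-1 - k.+1))%N).
    apply: leq_sum => e /andP[_ ke]; rewrite leq_pexp2l //; lia.
  by rewrite sum_nat_const leq_mul2r max_card orbT.
rewrite !split3 (eq_bigr (fun c : 'I_k => lev c Y * q ^ (m.-1 - c))%N); last first.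
  by move=> c _; rewrite eqXY.
rewrite ltn_add2l; apply: (@leq_trans ((lev k X).+1 * q ^ (m.-1 - k))%N).
  by rewrite mulSn addnC ltn_add2r.
by apply: leq_trans (leq_addr _ _); rewrite leq_mul2r ltXY orbT.
Qed.

(** The strict lexicographic comparison of the levels of X with a vector a, split
    according to the first difference. *)
Definition below a X : bool := [exists k : 'I_m, in_cut cl k a X].

Lemma belowP a X :
  reflect (exists2 k, (k < m)%N & in_cut cl k a X) (below a X).
Proof.
apply: (iffP existsP) => [[k H]|[k km H]]; first by exists k.
by exists (Ordinal km).
Qed.

Lemma le_lexP X Y :
  reflect (eta Ei X = eta Ei Y \/ below (lev^~ Y) X) (le_lex (eta Ei X) (eta Ei Y)).
Proof.
have H (k : 'I_m) : (eta Ei X k < eta Ei Y k) &&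
      [forall i : 'I_m, (i < k)%N ==> (eta Ei X i == eta Ei Y i)] = in_cut cl k (lev^~ Y) X.
  rewrite !eta_level ltz_nat andbC; congr (_ && _).
  apply/forallP/forallP => H c.
    by have /implyP := H (widen_ord (ltnW (ltn_ord k)) c); rewrite !eta_level; apply => /=.
  by apply/implyP => ck; have := H (Ordinal ck); rewrite !eta_level.
rewrite /le_lex; apply: (iffP orP) => -[/eqP->|h]; try by left.
  by right; case/existsP: h => k; rewrite H => h; apply/existsP; exists k.
by right; case/existsP: h => k h; apply/existsP; exists k; rewrite H.
Qed.

Lemma eq_eta_level X Y c : eta Ei X = eta Ei Y -> (c < m)%N -> lev c X = lev c Y.
Proof.
by move=> e cm; have /ffunP/(_ (Ordinal cm)) := e; rewrite !eta_level => -[].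
Qed.

(** A set that dominates a member of the k-th cut lies in one of the cuts 0, ..., k:
    this is why only the cuts before k matter in [tilted_pareto]. *)
Lemma in_cut_le_lex a k X Y : (k < m)%N -> in_cut cl k a X ->
  le_lex (eta Ei Y) (eta Ei X) -> exists2 j, (j <= k)%N & in_cut cl j a Y.
Proof.
move=> km /in_cutP[eqX ltX] /le_lexP[e|/belowP[l lm /in_cutP[eqY ltY]]].
  exists k => //; apply/in_cutP; split=> [c ck|]; last by rewrite (eq_eta_level e).
  by rewrite (eq_eta_level e (ltn_trans ck km)) eqX.
have [lk|kl] := ltnP l k.
  exists l; first exact: ltnW.
  apply/in_cutP; split=> [c cl'|]; last by rewrite -eqX.
  by rewrite eqY // eqX // (ltn_trans cl').
exists k => //; apply/in_cutP; split=> [c ck|]; first by rewrite eqY ?eqX // (leq_trans ck).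
move: kl; rewrite leq_eqVlt => /orP[/eqP e|/eqY->] //.
by rewrite -{}e in ltY; apply: ltn_trans ltX.
Qed.

Lemma below_le_lex a X Y : below a X -> le_lex (eta Ei Y) (eta Ei X) -> below a Y.
Proof.
move=> /belowP[k km cX] le; have [j jk cY] := in_cut_le_lex km cX le.
by apply/belowP; exists j => //; apply: leq_ltn_trans km.
Qed.

Lemma le_lex_total X Y : le_lex (eta Ei X) (eta Ei Y) \/ below (lev^~ X) Y.
Proof.
have [e|] := eqVneq (eta Ei X) (eta Ei Y); first by left; apply/le_lexP; left.
move=> ne.
have : exists c, (c < m)%N && (lev c X != lev c Y).
  have /existsP[c nc] : [exists c : 'I_m, lev c X != lev c Y].
    apply: contraNT ne; rewrite negb_exists => /forallP H.
    by apply/eqP/ffunP => c; rewrite !eta_level; have := H c; rewrite negbK => /eqP->.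
  by exists c; rewrite ltn_ord.
move=> ex; case: (ex_minnP ex) => k /andP[km nk] mink.
have low c : (c < k)%N -> lev c X = lev c Y.
  move=> ck; apply/eqP; apply: contraLR (ck) => nc; rewrite -leqNgt; apply: mink.
  by rewrite nc (ltn_trans ck).
have := nk; rewrite neq_ltn => /orP[lt|lt].
  by left; apply/le_lexP; right; apply/belowP; exists k => //; apply/in_cutP.
by right; apply/belowP; exists k => //; apply/in_cutP; split=> // c /low.
Qed.

Lemma below_irr X : ~~ below (lev^~ X) X.
Proof. by apply/belowP => -[k _ /in_cutP[_]]; rewrite ltnn. Qed.

Lemma pareto_le X Y : pareto_optimal P g Ei X -> Y \in P -> g Y <= g X ->
  le_lex (eta Ei Y) (eta Ei X) -> value g Ei Y = value g Ei X.
Proof.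
move=> /andP[_ nX] YP le1 le2; apply/eqP; apply: contraNT nX => ne.
by apply/existsP; exists Y; rewrite YP le1 le2 ne.
Qed.

Lemma pareto_below X Y : pareto_optimal P g Ei X -> pareto_optimal P g Ei Y ->
  g X < g Y -> below (lev^~ X) Y.
Proof.
move=> pX pY lt; have [le|//] := le_lex_total X Y.
have /andP[XP _] := pX; have [e _] := pareto_le pY XP (ltW lt) le.
by rewrite e ltxx in lt.
Qed.

Lemma pareto_value_eta X Y : pareto_optimal P g Ei X -> pareto_optimal P g Ei Y ->
  eta Ei X = eta Ei Y -> value g Ei X = value g Ei Y.
Proof.
move=> pX pY e; have [XP YP] : X \in P /\ Y \in P by case/andP: pX pY => ? _ /andP[].
have [le|lt] := leP (g X) (g Y).
  by apply: (pareto_le pY) => //; apply/le_lexP; left.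
by apply/esym/(pareto_le pX) => //; [apply: ltW|apply/le_lexP; left].
Qed.

Lemma lex_weight_eta X Y : eta Ei X = eta Ei Y -> lex_weight X = lex_weight Y.
Proof.
have sumE Z : lex_weight Z = (\sum_(i < m) lev i Z * q ^ (m.-1 - i))%N.
  rewrite /lex_weight (partition_big part xpredT) //=; apply: eq_bigr => i _.
  by rewrite /level -sum_nat_const; apply: eq_big => [z|z /andP[_ /eqP->]] //; rewrite inE.
by move=> e; rewrite !sumE; apply: eq_bigr => i _; rewrite (eq_eta_level e).
Qed.

Definition tilted (eps : R) X : R := g X + eps * (lex_weight X)%:R.

(** The tilt is too small to lift g(X) from g(X0) to B, since lex_weight ranges
    below (|E| + 1)^m.  Hence a set dominating X lies in no cut before the k-th,
    and within the k-th cut it would have a smaller tilted value. *)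
Lemma tilted_pareto a k (B : R) X0 X : (k < m)%N ->
  X0 \in P -> in_cut cl k a X0 -> g X0 < B ->
  (forall j Y, (j < k)%N -> Y \in P -> in_cut cl j a Y -> B <= g Y) ->
  X \in P -> in_cut cl k a X ->
  (forall Y, Y \in P -> in_cut cl k a Y ->
     tilted ((B - g X0) / (q ^ m)%:R) X <= tilted ((B - g X0) / (q ^ m)%:R) Y) ->
  g X < B /\ pareto_optimal P g Ei X.
Proof.
move=> km X0P X0k ltB minB XP Xk; set eps := _ / _ => minX.
have m0 : (0 < m)%N by apply: leq_ltn_trans km.
have Q0 : 0 < (q ^ m)%:R :> R by rewrite ltr0n expn_gt0.
have eps0 : 0 < eps by rewrite divr_gt0 // subr_gt0.
have eQ : eps * (q ^ m)%:R = B - g X0 by rewrite divfK // lt0r_neq0.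
have gXB : g X < B.
  have := minX X0 X0P X0k; rewrite /tilted => le.
  have w0 : 0 <= eps * (lex_weight X)%:R by rewrite mulr_ge0 // ltW.
  have w1 : eps * (lex_weight X0)%:R < eps * (q ^ m)%:R.
    by rewrite ltr_pM2l // ltr_nat lex_weight_bound.
  by lra.
split=> //; rewrite /pareto_optimal XP /=; apply/existsP => -[Y /and4P[YP leg lee ne]].
have [j jk Yj] := in_cut_le_lex km Xk lee.
have [jk'|] := ltnP j k; first by have := minB j Y jk' YP Yj; lra.
move=> kj; have {jk kj}ejk : j = k by apply/eqP; rewrite eqn_leq jk.
subst j; have := minX Y YP Yj; rewrite /tilted.
case/le_lexP: lee => [e|/belowP[l lm /in_cutP[low lt]]].
  have le2 : g Y < g X.
    rewrite lt_neqAle leg andbT; apply: contraNneq ne => eg.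
    by rewrite /value eg e.
  by rewrite (lex_weight_eta e); move: le2; lra.
have := lex_weight_lt lm low lt; rewrite -(ltr_nat R) -(ltr_pM2l eps0); move: leg; lra.
Qed.

(** The state of the enumeration.  The Pareto optimal values not below a are exactly
    those of outs; stk holds Pareto optimal sets below a with decreasing g, so
    that its last element is the next of them in the order of the enumeration. *)
Definition progress a (outs stk : seq {set E}) : Prop :=
  [/\ all (fun X => pareto_optimal P g Ei X && ~~ below a X) outs,
      uniq (map (value g Ei) outs),
      forall Y, pareto_optimal P g Ei Y -> ~~ below a Y ->
        value g Ei Y \in map (value g Ei) outs,
      all (fun X => pareto_optimal P g Ei X && below a X) stk
    & pairwise (fun X Y => g Y < g X) stk].

Lemma progress_size a outs stk : progress a outs stk ->
  (size outs + size stk <= num_pareto_values P g Ei)%N.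
Proof.
case=> /allP pO uO _ /allP pS sS.
rewrite -size_cat -(size_map (value g Ei)); apply: uniq_leq_size.
  rewrite map_cat cat_uniq uO /=; apply/andP; split.
    apply/hasPn => v /mapP[X XS ->]; apply/mapP => -[Y YO [_ e]].
    have /andP[_ bX] := pS X XS; have /andP[_ /negP] := pO Y YO; apply.
    by apply: below_le_lex bX _; apply/le_lexP; left.
  elim: stk sS {pS} => //= X stk IH /andP[/allP lt /IH ->]; rewrite andbT.
  by apply/mapP => -[Y /lt + [e _]]; rewrite e ltxx.
move=> v /mapP[X + ->]; rewrite mem_cat mem_undup => XX.
apply/imageP; exists X => //.
by case/orP: XX => [/pO|/pS] /andP[].
Qed.

Lemma progress_push a outs stk X : progress a outs stk -> pareto_optimal P g Ei X ->
  below a X -> all (fun Y => g X < g Y) stk -> progress a outs (rcons stk X).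
Proof.
by case=> pO uO cO pS sS pX bX lt; split; rewrite // ?all_rcons ?pairwise_rcons ?pX ?bX ?lt.
Qed.

(** Nothing is skipped: a Pareto optimal Y below a and not below Z has
    g(Y) >= g(Z) and an eta at least that of Z, so its value is that of Z. *)
Lemma progress_pop a outs stk Z : progress a outs (rcons stk Z) ->
  (forall Y, Y \in P -> below a Y -> g Z <= g Y) ->
  progress (lev^~ Z) (rcons outs Z) stk.
Proof.
case=> pO uO cO; rewrite all_rcons pairwise_rcons => /andP[/andP[pZ bZ] pS] /andP[lt sS] minZ.
split.
- rewrite all_rcons pZ below_irr; apply/allP => Y /(allP pO)/andP[-> nb] /=.
  apply: contra nb => bY; apply: below_le_lex bZ _.
  by apply/le_lexP; right.
- rewrite map_rcons rcons_uniq uO andbT; apply/mapP => -[Y /(allP pO)/andP[_ nb] [_ e]].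
  by case/negP: nb; apply: below_le_lex bZ _; apply/le_lexP; left.
- move=> Y pY nY; rewrite map_rcons mem_rcons inE.
  have [bY|nb] := boolP (below a Y); last by rewrite cO ?orbT.
  have [/andP[YP _] /andP[ZP _]] := (pY, pZ).
  have [le|b] := le_lex_total Z Y; last by rewrite b in nY.
  by rewrite (pareto_le pY ZP (minZ Y YP bY) le) eqxx.
- apply/allP => Y YS; have /andP[pY _] := allP pS _ YS; rewrite pY /=.
  by apply: pareto_below => //; apply: (allP lt).
- by [].
Qed.

Lemma progress_end a outs : progress a outs [::] ->
  (forall Y, Y \in P -> ~~ below a Y) ->
  perm_eq (map (value g Ei) outs) (pareto_values P g Ei).
Proof.
case=> /allP pO uO cO _ _ nb; apply: uniq_perm; rewrite ?undup_uniq //.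
move=> v; rewrite mem_undup; apply/idP/idP.
  by move=> /mapP[X /pO/andP[pX _] ->]; apply/imageP; exists X.
by move=> /imageP[X pX ->]; apply: cO => //; apply: nb; case/andP: pX.
Qed.

(** A vector above all levels.  Its zeros make all cuts but the first empty, so that
    only the trivially satisfied condition on level 0 remains. *)
Definition top_bound (c : nat) : nat := if c == 0%N then #|E|.+1 else 0%N.

Lemma below_top X : (0 < m)%N -> below top_bound X.
Proof.
move=> m0; apply/belowP; exists 0%N => //; apply/in_cutP; split=> //.
by rewrite /top_bound eqxx ltnS level_card.
Qed.

Lemma progress_init : (0 < m)%N -> progress top_bound [::] [::].
Proof. by move=> m0; split=> // Y _; rewrite below_top. Qed.

End Pareto.

(** * Timed execution of programs *)

Section Runs.
Local Open Scope nat_scope.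
Variables (R : realType) (F : finType) (ask : nat -> {set F} -> \bar R).
Implicit Types (s : state R) (c : cmd) (Q : state R -> Prop).

(** Total correctness within time b, as a weakest precondition. *)
Definition run c s (b : nat) Q : Prop :=
  exists s' t, [/\ exec ask c s s' t, t <= b & Q s'].

Lemma run_weaken c s b b' Q Q' : run c s b Q -> b <= b' -> (forall s', Q s' -> Q' s') ->
  run c s b' Q'.
Proof.
by move=> [s' [t [ex le q]]] bb H; exists s', t; split=> //; [apply: leq_trans bb|apply: H].
Qed.

Lemma run_le b c s b' Q : run c s b Q -> b <= b' -> run c s b' Q.
Proof. by move=> r le; apply: run_weaken r le _. Qed.

Lemma run_post c s b Q Q' : run c s b Q -> (forall s', Q s' -> Q' s') -> run c s b Q'.
Proof. by move=> r H; apply: run_weaken r (leqnn _) H. Qed.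

Lemma run_skip s Q : Q s -> run Skip s 1 Q.
Proof. by move=> q; exists s, 1; split=> //; constructor. Qed.

Lemma run_setn a i e s Q : Q (setn s a (neval s i) (neval s e)) -> run (SetN a i e) s 1 Q.
Proof. by move=> q; eexists _, 1; split; [constructor| |exact: q]. Qed.

Lemma run_setr a i e s Q : Q (setr s a (neval s i) (reval s e)) -> run (SetR a i e) s 1 Q.
Proof. by move=> q; eexists _, 1; split; [constructor| |exact: q]. Qed.

Lemma run_query q a y z s Q :
  (let v := ask q (array_set F (nmem s a)) in
   Q (setn (setr s y 0 (fine v)) z 0 (v \is a fin_num))) ->
  run (Query q a y z) s #|F|.+1 Q.
Proof. by move=> H; eexists _, _; split; [constructor| |exact: H]. Qed.

Lemma run_seq b1 b2 c1 c2 s Q : run c1 s b1 (fun s1 => run c2 s1 b2 Q) ->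
  run (Seq c1 c2) s (b1 + b2) Q.
Proof.
move=> [s1 [t1 [e1 l1 [s2 [t2 [e2 l2 q]]]]]].
by exists s2, (t1 + t2); split=> //; [apply: ExecSeq e1 e2|apply: leq_add].
Qed.

Lemma run_if b c1 c2 s k Q : run (if teval s b then c1 else c2) s k Q ->
  run (If b c1 c2) s k.+1 Q.
Proof. by move=> [s' [t [e l q]]]; exists s', t.+1; split=> //; constructor. Qed.

(** The index of the invariant bounds the number of remaining iterations. *)
Lemma run_while (I : nat -> state R -> Prop) b c tau :
  (forall M s, I M s -> teval s b -> run c s tau (fun s' => exists2 M', M' < M & I M' s')) ->
  forall M s, I M s ->
  run (While b c) s (M * tau.+1).+1 (fun s' => ~~ teval s' b /\ exists M', I M' s').
Proof.
move=> step M; have [N] := ubnP M; elim: N M => // N IH M leM s Is.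
have [tb|ntb] := boolP (teval s b); last first.
  by exists s, 1; split=> //; [apply: ExecWhileStop|split=> //; exists M].
have [s1 [t1 [e1 l1 [M' ltM I1]]]] := step M s Is tb.
have [|s2 [t2 [e2 l2 q]]] := IH M' _ s1 I1; first by apply: leq_trans ltM _.
exists s2, (t1 + t2).+1; split=> //; first exact: ExecWhileStep e1 e2.
have : (M'.+1 * tau.+1 <= M * tau.+1) by rewrite leq_mul2r ltM orbT.
by rewrite mulSn; lia.
Qed.

Definition var a : nexp := NCell a (NConst 0).

Definition For x (bound : nexp) (body : cmd) : cmd :=
  Seq (SetN x (NConst 0) (NConst 0))
    (While (TNot (TLeN bound (var x)))
       (Seq body (SetN x (NConst 0) (NAdd (var x) (NConst 1))))).

Lemma run_for (I : nat -> state R -> Prop) N tau x bound body s :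
  I 0 (setn s x 0 0) ->
  (forall i s, i <= N -> nmem s x 0 = i -> I i s -> neval s bound = N) ->
  (forall i s, i < N -> nmem s x 0 = i -> I i s ->
     run body s tau (fun s' => nmem s' x 0 = i /\ I i.+1 (setn s' x 0 i.+1))) ->
  run (For x bound body) s (N * (tau + 2) + 2) (fun s' => nmem s' x 0 = N /\ I N s').
Proof.
move=> I0 eN step.
pose J M s := exists i, [/\ i <= N, M = N - i, nmem s x 0 = i & I i s].
apply: (@run_weaken _ _ (1 + (N * (tau + 1).+1).+1) _
   (fun s' => ~~ teval s' (TNot (TLeN bound (var x))) /\ exists M', J M' s')); first last.
- move=> s' [+ [M [i [iN _ ei Ii]]]]; rewrite /= negbK (eN i) // ei => Ni.
  have {Ni}iN' : i = N by apply/eqP; rewrite eqn_leq iN.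
  by rewrite iN' in ei Ii.
- lia.
apply: run_seq; apply: run_setn; apply: run_while; last first.
  by exists 0; split=> //; rewrite ?subn0 //= /update !eqxx.
move=> M {I0}s [i [iN -> ei Ii]] /=; rewrite (eN i) // ei -ltnNge => ltN.
apply: run_seq; apply: run_weaken (step i s ltN ei Ii) (leqnn _) _ => s' [ei' Ii'].
apply: run_setn; exists (N - i.+1); first lia.
by exists i.+1; split=> //=; rewrite ei' addn1 // /update !eqxx.
Qed.

(** Only the natural arrays ns and the real arrays rs may change. *)
Definition frame (ns rs : seq nat) s s' : Prop :=
  (forall a i, a \notin ns -> nmem s' a i = nmem s a i) /\
  (forall a i, a \notin rs -> rmem s' a i = rmem s a i).

Lemma frame_weak ns rs ns' rs' s1 s2 : frame ns rs s1 s2 ->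
  all (fun a => a \in ns') ns -> all (fun a => a \in rs') rs -> frame ns' rs' s1 s2.
Proof.
move=> [n1 r1] /allP sn /allP sr.
by split=> a i h; [apply: n1|apply: r1]; apply: contra h; [apply: sn|apply: sr].
Qed.

Lemma frame_setn ns rs s0 s a i v : frame ns rs s0 s -> a \in ns -> frame ns rs s0 (setn s a i v).
Proof.
move=> [n1 r1] ains; split=> // a' i' h; rewrite /= /update.
by case: eqVneq => [e|_] /=; [rewrite e ains in h|apply: n1].
Qed.

Lemma frame_setr ns rs s0 s a i v : frame ns rs s0 s -> a \in rs -> frame ns rs s0 (setr s a i v).
Proof.
move=> [n1 r1] ains; split=> // a' i' h; rewrite /= /update.
by case: eqVneq => [e|_] /=; [rewrite e ains in h|apply: r1].
Qed.

Lemma nmem_setn s a i v a' i' :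
  nmem (setn s a i v) a' i' = if (a' == a) && (i' == i) then v else nmem s a' i'.
Proof. by []. Qed.

Lemma rmem_setr s a i v a' i' :
  rmem (setr s a i v) a' i' = if (a' == a) && (i' == i) then v else rmem s a' i'.
Proof. by []. Qed.

Lemma nmem_setr s a i v : nmem (setr s a i v) = nmem s.
Proof. by []. Qed.

Lemma rmem_setn s a i v : rmem (setn s a i v) = rmem s.
Proof. by []. Qed.

End Runs.

Section Determinism.
Local Open Scope nat_scope.
Variables (R : realType) (F : finType).
Implicit Types (s : state R) (c : cmd) (ask : nat -> {set F} -> \bar R).

Lemma exec_det ask c s s1 t1 s2 t2 :
  exec ask c s s1 t1 -> exec ask c s s2 t2 -> s1 = s2.
Proof.
move=> e; elim: e s2 t2 => {c s s1 t1}.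
- by move=> s s2 t2 e; inversion e.
- by move=> a i e s s2 t2 h; inversion h.
- by move=> a i e s s2 t2 h; inversion h.
- move=> c1 c2 s s1 s2 t1 t2 _ IH1 _ IH2 s3 t3 h; inversion h; subst.
  match goal with H : exec _ c1 _ _ _, H' : exec _ c2 _ _ _ |- _ =>
    by move: H'; rewrite -(IH1 _ _ H); apply: IH2 end.
- by move=> b c1 c2 s s' t _ IH s2 t2 h; inversion h; subst;
  match goal with H : exec _ (if _ then _ else _) _ _ _ |- _ => apply: IH H end.
- move=> b c s nb s2 t2 h; inversion h; subst => //.
  by match goal with H : is_true (teval _ _) |- _ => rewrite H in nb end.
- move=> b c s s1 s2 t1 t2 tb _ IH1 _ IH2 s3 t3 h; inversion h; subst.
    by match goal with H : is_true (~~ teval _ _) |- _ => rewrite tb in H end.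
  match goal with H : exec _ c _ _ _, H' : exec _ (While _ _) _ _ _ |- _ =>
    by move: H'; rewrite -(IH1 _ _ H); apply: IH2 end.
- by move=> q a y z s v s2 t2 h; inversion h.
Qed.

(** Any query takes more than |F| steps. *)
Lemma exec_quick ask ask' c s s' t : exec ask c s s' t -> t <= #|F| -> exec ask' c s s' t.
Proof.
elim => {c s s' t}; try by [constructor|move=> *; constructor].
- move=> c1 c2 s s1 s2 t1 t2 _ IH1 _ IH2 le.
  by apply: ExecSeq (IH1 _) (IH2 _); apply: leq_trans le; rewrite ?leq_addr ?leq_addl.
- by move=> b c1 c2 s s' t _ IH le; constructor; apply: IH; apply: ltnW.
- move=> b c s s1 s2 t1 t2 tb _ IH1 _ IH2 le.
  apply: ExecWhileStep (IH1 _) (IH2 _) => //; apply: leq_trans (ltnW le);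
  by rewrite ?leq_addr ?leq_addl.
- by move=> *; lia.
Qed.

Lemma exec_pos ask c s s' t : exec ask c s s' t -> 0 < t.
Proof. by elim=> // *; rewrite addn_gt0; apply/orP; left. Qed.

End Determinism.

(** * Lower bound on the time of valuated matroid intersection *)

Section LowerBound.
Variables (R : realType) (vmi : cmd) (T : nat -> nat).
Hypothesis solves : solves_VMI R vmi T.

Lemma array_set_ord N (f : nat -> nat) (i : 'I_N) : (i \in array_set 'I_N f) = (f i != 0%N).
Proof. by rewrite inE enum_rank_ord. Qed.

Definition uniform1 N : {set {set 'I_N}} := [set Z : {set 'I_N} | #|Z| == 1%N].

Lemma valuated_uniform1 N (h : {set 'I_N.+1} -> R) :
  valuated_matroid (on_family (uniform1 N.+1) h).
Proof.
apply: valuated_on_family.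
  by apply/set0Pn; exists [set ord0]; rewrite inE cards1.
move=> X Y u; rewrite ![_ \in uniform1 _]inE => /cards1P[x ->] /cards1P[y ->].
rewrite !inE => /andP[uy /eqP ux]; subst u; exists y; first by rewrite !inE eqxx eq_sym uy.
have e1 : y |: ([set x] :\ x) = [set y] by apply/setP => z; rewrite !inE; case: (z == x); rewrite ?orbF.
have e2 : (x |: [set y]) :\ y = [set x].
  by apply/setP => z; rewrite !inE; case: (eqVneq z y) => [->|]; rewrite ?orbF //= eq_sym (negbTE uy).
by rewrite e1 e2 !inE !cards1; split=> //; lra.
Qed.

(** An execution of at most 2n steps contains no query.  On the rank-one uniform
    matroid (n > 0), give the first element weight 1 or -1 and all others weight
    0: it must be avoided in one case and chosen in the other, but without
    queries both executions end in the same state. *)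
Lemma vmi_time_lower_bound n : ((n + n).+1 <= T (n + n))%N.
Proof.
case: n => [|n].
  pose w := on_family [set set0 : {set 'I_0}] (fun=> 0 : R).
  have vw : valuated_matroid w.
    apply: valuated_on_family => [|X Y []//].
    by apply/set0Pn; exists set0; rewrite inE.
  have [|s' [t [/exec_pos]]] := solves (s := State (fun _ _ => 0%N) (fun _ _ => 0)) (leqnn _) vw vw.
    split; rewrite ?card_ord // /w dom_on_family inE; apply/eqP/setP; by case.
  by rewrite card_ord => t0 le _; apply: leq_trans le.
set N := (n.+1 + n.+1)%N; have eN : N = (n + n).+2 by rewrite /N addnS addSn.
rewrite eN; clearbody N; clear eN; set M := (n + n)%N.
rewrite leqNgt; apply/negP => ltT.
pose h (sg : R) (Z : {set 'I_M.+2}) : R := if ord0 \in Z then sg else 0.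
pose s0 : state R := State (fun a i => if a == 0%N then M.+2 else (i == 0)%N : nat) (fun _ _ => 0).
pose w sg := on_family (uniform1 M.+2) (h sg).
have inp sg : vmi_input (w sg) (w 0) s0.
  have e a : a != 0%N -> array_set 'I_M.+2 (nmem s0 a) = [set ord0].
    move=> /negbTE a0; apply/setP => i; rewrite array_set_ord /= a0 inE.
    by rewrite -val_eqE /=; case: (val i == 0)%N.
  by split; rewrite ?card_ord // /w dom_on_family e // inE cards1.
have sol sg := solves (leqnn _) (valuated_uniform1 (h sg)) (valuated_uniform1 (h 0)) (inp sg).
have [s1 [t1 [ex1 le1 out1]]] := sol 1.
have [s2 [t2 [ex2 le2 out2]]] := sol (- 1).
have e12 : s1 = s2.
  apply: exec_det (exec_quick (vmi_oracle (w (- 1)) (w 0)) ex1 _) ex2.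
  by rewrite card_ord in le1 *; apply: leq_trans le1 _; rewrite -ltnS.
rewrite {}e12 in out1; rewrite -!/(w _) in out1 out2; pose X := array_set 'I_M.+2 (nmem s2 4).
have ne sg : dom (w sg) :&: dom (w 0) != set0.
  by apply/set0Pn; exists [set ord0]; rewrite /w !dom_on_family !inE cards1.
have val sg (Y : {set 'I_M.+2}) : #|Y| == 1%N -> (w sg Y + w 0%R Y)%E = (h sg Y)%:E.
  by move=> Y1; rewrite /w /on_family !inE Y1 -EFinD /h if_same addr0.
case: out1 => [[_ /eqP]|[_ XD opt1]]; first by rewrite (negbTE (ne 1)).
rewrite -/X in XD opt1; case: out2 => [[_ /eqP]|[_ _ opt2]]; first by rewrite (negbTE (ne _)).
rewrite -/X in opt2; have X1 : #|X| == 1%N by move: XD; rewrite /w !dom_on_family !inE => /andP[].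
have := opt1 [set ord_max]; have := opt2 [set ord0].
rewrite !val ?cards1 // !lee_fin /h !inE -!val_eqE /=.
by case: (nmem s2 4 _ != 0%N); lra.
Qed.

End LowerBound.

(** * Memory layout and counting loops *)

Local Open Scope nat_scope.
(** Arrays are named by numerals, so that distinctness of names is decided by
    computation.  The first names of each kind are those prescribed for input and
    output.  aBound holds the vector a and aSet, once a value has been listed, the
    set whose levels form a; aStk (sets, |E| cells each) and rStk (values of g)
    hold the stack, aDepth and aStkPos its height in entries and in cells.
    aK is the index of the current cut.  During a scan, rMin is the smallest value
    of g so far, aFound tells whether there is one, aImproved whether it comes
    from a cut (then aBest) rather than from the top of the stack.  In that case rGap
    is a value above rMin that g does not go below on the cuts before aBest, nor
    at the top of the stack.  rPow holds the powers of |E| + 1 and rEps the factor of the tilt. *)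
Notation aN := 0 (only parsing).
Notation aM := 1 (only parsing).
Notation aPart := 2 (only parsing).
Notation aInit := 3 (only parsing).
Notation aOut := 4 (only parsing).
Notation aEta := 5 (only parsing).
Notation aBound := 6 (only parsing).
Notation aSet := 7 (only parsing).
Notation aStk := 8 (only parsing).
Notation aK := 9 (only parsing).
Notation aI := 10 (only parsing).
Notation aTot := 11 (only parsing).
Notation aCnt := 12 (only parsing).
Notation aFlag := 13 (only parsing).
Notation aDepth := 14 (only parsing).
Notation aStkPos := 15 (only parsing).
Notation aEtaPos := 16 (only parsing).
Notation aImproved := 17 (only parsing).
Notation aFound := 18 (only parsing).
Notation aBest := 19 (only parsing).
Notation aRun := 20 (only parsing).
Notation rOut := 0 (only parsing).
Notation rPow := 1 (only parsing).
Notation rEps := 2 (only parsing).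
Notation rMin := 3 (only parsing).
Notation rGap := 4 (only parsing).
Notation rStk := 5 (only parsing).
Notation rVal := 6 (only parsing).
Notation rAcc := 7 (only parsing).

(** Where the arrays of the intersection algorithm are stored: 24 exceeds all the
    names above. *)
Definition sh (a : nat) : nat := a.+4.+4.+4.+4.+4.+4.

Local Coercion NConst : nat >-> nexp.
Local Notation V := var.

(** Truncated subtraction maps zero to 0 and everything else to 1. *)
Definition indicator (e : nexp) : nexp := NSub 1 (NSub 1 e).

Definition Total (z : nat) : cmd :=
  Seq (SetN aTot 0 0)
    (For aI (NAdd (V aN) (V aN))
       (SetN aTot 0 (NAdd (V aTot) (indicator (NCell z (V aI)))))).

(** As programs cannot multiply naturals, weights are real numbers taken from a table. *)
Definition Weight (z : nat) : cmd :=
  Seq (SetR rAcc 0 (ROfNat 0))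
    (For aI (V aN)
       (If (TLeN (NCell z (V aI)) 0) Skip
          (SetR rAcc 0 (RAdd (RCell rAcc 0)
             (RCell rPow (NSub (NSub (V aM) 1) (NCell aPart (V aI)))))))).

(** The time of a query must not depend on m, so only the levels of existing
    elements are cleared. *)
Definition ClearLevels (d : nat) : cmd :=
  For aI (V aN) (SetN d (NCell aPart (V aI)) 0).

Definition AddLevels (z d : nat) : cmd :=
  For aI (V aN)
    (SetN d (NCell aPart (V aI))
       (NAdd (NCell d (NCell aPart (V aI))) (indicator (NCell z (V aI))))).

Definition dist (x y : nexp) : nexp := NAdd (NSub x y) (NSub y x).

(** The test runs over the elements instead of over the levels, again to avoid the
    dependence on m; [level_ok_in_cut] shows that empty parts cause no error. *)
Definition CheckLevels : cmd :=
  let p := NCell aPart (V aI) in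
  let reject := SetN aFlag 0 0 in
  Seq (SetN aFlag 0 1)
    (For aI (V aN)
       (If (TLeN p (V aK))
          (If (TLeN (V aK) p)
             (If (TLeN (NCell aBound p) (NCell aCnt p)) reject Skip)
             (If (TLeN (dist (NCell aCnt p) (NCell aBound p)) 0) Skip reject))
          Skip)).

Section Loops.
Variables (R : realType) (F E : finType) (ask : nat -> {set F} -> \bar R).
Variables (m : nat) (part : E -> 'I_m).
Implicit Types (s : state R).
Local Notation n := (#|E|).
Local Notation run := (run ask).
Local Notation lev := (level (fun e => part e : nat)).
Local Open Scope nat_scope.

Definition static s : Prop :=
  [/\ nmem s aN 0 = n, nmem s aM 0 = m & forall e, nmem s aPart (enum_rank e) = part e].

Lemma sub1_sub1 k : 1 - (1 - k) = (k != 0).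
Proof. by case: k => // k; rewrite subSS sub0n. Qed.

Lemma sum_enum_rank (W : nmodType) (h : nat -> W) (p : pred nat) :
  (\sum_(i < n | p i) h i = \sum_(e : E | p (enum_rank e : nat)) h (enum_rank e : nat))%R.
Proof. by rewrite (reindex (@enum_rank E)) //; apply: onW_bij; apply: enum_rank_bij. Qed.

Lemma sum_enum_rankN (h : nat -> nat) :
  \sum_(i < n) h i = \sum_(e : E) h (enum_rank e : nat).
Proof. by rewrite (reindex (@enum_rank E)) //; apply: onW_bij; apply: enum_rank_bij. Qed.

Lemma card_array_set N (f : nat -> nat) : #|array_set 'I_N f| = \sum_(i < N) (f i != 0).
Proof.
rewrite -sum1_card big_mkcond; apply: eq_bigr => i _.
by rewrite array_set_ord; case: ifP.
Qed.

Lemma in_array_set (f : nat -> nat) (e : E) : (e \in array_set E f) = (f (enum_rank e) != 0).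
Proof. by rewrite inE. Qed.

Lemma rank_lt (e : E) : enum_rank e < n.
Proof. exact: ltn_ord. Qed.

Lemma run_total z s : z != aI -> z != aTot -> nmem s aN 0 = n ->
  run (Total z) s (6 * n + 3) (fun s' => frame [:: aI; aTot] [::] s s' /\
    nmem s' aTot 0 = #|array_set 'I_(n + n) (nmem s z)|).
Proof.
move=> zI zT eN; apply: (@run_le _ _ _ (1 + ((n + n) * (1 + 2) + 2))); last by lia.
apply: run_seq; apply: run_setn; set s1 := setn _ _ _ _.
pose I i s' := frame [:: aI; aTot] [::] s s' /\
   nmem s' aTot 0 = \sum_(j < i) (nmem s z j != 0).
apply: run_post (run_for (I := I) (N := n + n) (tau := 1) _ _ _) _.
- split; first by do 2!apply: frame_setn => //.
  by rewrite big_ord0.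
- by move=> i s' _ _ [[fr _] _]; rewrite /= fr //= eN.
- move=> i s' iN ei [fr et]; apply: run_setn; split=> //; split.
    by do 2!apply: frame_setn => //.
  rewrite big_ord_recr /= /update /= -et; congr (_ + _).
  by rewrite ei sub1_sub1 (proj1 fr) // !inE negb_or zI.
- by move=> s' [_ [fr ->]]; rewrite card_array_set.
Qed.


Lemma run_weight z s : z != aI -> static s ->
  (forall i, i < m -> rmem s rPow i = (n.+1 ^ i)%:R%R) ->
  run (Weight z) s (4 * n + 3) (fun s' => frame [:: aI] [:: rAcc] s s' /\
    rmem s' rAcc 0 = (lex_weight part (array_set E (nmem s z)))%:R%R).
Proof.
move=> zI [eN eM eP] ePow.
apply: (@run_le _ _ _ (1 + (n * (2 + 2) + 2))); last by lia.
apply: run_seq; apply: run_setr; set s1 := setr _ _ _ _.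
pose I i s' := frame [:: aI] [:: rAcc] s s' /\ (rmem s' rAcc 0 =
   \sum_(j < i | nmem s z j != 0) rmem s rPow (m - 1 - nmem s aPart j))%R.
apply: run_post (run_for (I := I) (N := n) (tau := 2) _ _ _) _.
- split; first by apply: frame_setn => //; apply: frame_setr.
  by rewrite big_ord0.
- by move=> i s' _ _ [[fr _] _]; rewrite /= fr //= eN.
- move=> i s' iN ei [fr et]; have [frn frr] := fr.
  have ez : neval s' (NCell z (V aI)) = nmem s z i.
    by rewrite /= ei frn // !inE zI.
  apply: run_if; rewrite [teval _ _]/= -[nmem s' z _]/(neval s' (NCell z (V aI))) ez leqn0.
  have [z0|z0] := eqVneq (nmem s z i) 0.
    apply: run_skip; split=> //; split; first exact: frame_setn.
    by rewrite big_mkcond big_ord_recr /= -big_mkcond /= z0 addr0 -et.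
  apply: run_setr; split=> //; split; first by apply: frame_setn => //; apply: frame_setr.
  rewrite big_mkcond big_ord_recr /= -big_mkcond /= z0 -et /update /= ei; congr (_ + _)%R.
  by rewrite !frn // frr // eM.
- move=> s' [_ [fr ->]]; split=> //.
  rewrite (sum_enum_rank (fun j => rmem s rPow (m - 1 - nmem s aPart j)) (fun j => nmem s z j != 0)).
  rewrite /lex_weight natr_sum; apply: eq_big => e; first by rewrite in_array_set.
  by move=> _; rewrite eP ePow ?subn1 //; have := ltn_ord (part e); lia.
Qed.

Lemma run_clear_levels d s : d != aI -> d != aN -> d != aPart -> static s ->
  run (ClearLevels d) s (3 * n + 2) (fun s' => frame [:: aI; d] [::] s s' /\
    forall e, nmem s' d (part e) = 0).
Proof.
move=> dI dN dP [eN eM eP].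
apply: (@run_le _ _ _ (n * (1 + 2) + 2)); last by lia.
pose I i s' := frame [:: aI; d] [::] s s' /\
   forall e, enum_rank e < i -> nmem s' d (part e) = 0.
apply: run_post (run_for (I := I) (N := n) (tau := 1) _ _ _) _.
- by split=> //; apply: frame_setn.
- by move=> i s' _ _ [[fr _] _]; rewrite /= fr // !inE [aN == d]eq_sym (negbTE dN).
- move=> i s' iN ei [fr et]; have [frn _] := fr.
  have dI' : (aI == d) = false by rewrite eq_sym (negbTE dI).
  apply: run_setn; split; first by rewrite /= /update dI'.
  split; first by do 2!apply: frame_setn => //; rewrite !inE eqxx orbT.
  move=> e; rewrite ltnS leq_eqVlt /= /update (negbTE dI) eqxx /= => /orP[/eqP er|er].
    by rewrite ei frn ?inE ?[aPart == d]eq_sym ?(negbTE dP) // -er eP eqxx.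
  by case: ifP => // _; apply: et.
- by move=> s' [_ [fr H]]; split=> // e; apply: H; apply: rank_lt.
Qed.

Lemma run_add_levels z d s : d != aI -> d != aN -> d != aPart -> z != aI -> z != d -> static s ->
  run (AddLevels z d) s (3 * n + 2) (fun s' => frame [:: aI; d] [::] s s' /\
    forall c, nmem s' d c = nmem s d c + lev c (array_set E (nmem s z))).
Proof.
move=> dI dN dP zI zd [eN eM eP].
apply: (@run_le _ _ _ (n * (1 + 2) + 2)); last by lia.
pose I i s' := frame [:: aI; d] [::] s s' /\
   forall c, nmem s' d c = nmem s d c + \sum_(j < i) ((nmem s z j != 0) && (nmem s aPart j == c)).
apply: run_post (run_for (I := I) (N := n) (tau := 1) _ _ _) _.
- split; first exact: frame_setn.
  by move=> c; rewrite /= /update (negbTE dI) big_ord0 addn0.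
- by move=> i s' _ _ [[fr _] _]; rewrite /= fr // !inE [aN == d]eq_sym (negbTE dN).
- move=> i s' iN ei [fr et]; have [frn _] := fr.
  have dI' : (aI == d) = false by rewrite eq_sym (negbTE dI).
  apply: run_setn; split; first by rewrite /= /update dI'.
  split; first by do 2!apply: frame_setn => //; rewrite !inE eqxx orbT.
  move=> c; rewrite big_ord_recr /= /update (negbTE dI) eqxx /= ei.
  rewrite (frn aPart) ?inE ?[aPart == d]eq_sym ?(negbTE dP) // [c == _]eq_sym.
  rewrite (frn z) ?inE ?(negbTE zI) ?(negbTE zd) // sub1_sub1.
  case: eqVneq => [<-|_]; first by rewrite andbT et addnA.
  by rewrite andbF addn0 et.
- move=> s' [_ [fr H]]; split=> // c; rewrite H; congr (_ + _).
  rewrite (sum_enum_rankN (fun j => (nmem s z j != 0) && (nmem s aPart j == c))).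
  rewrite /level -[RHS]sum1_card [RHS]big_mkcond; apply: eq_bigr => e _.
  by rewrite !inE eP; case: (_ && _).
Qed.

Definition level_ok k (bd cnt : nat -> nat) p : bool :=
  ((p < k) ==> (cnt p == bd p)) && ((p == k) ==> (cnt p < bd p)).

Lemma run_check_levels s : static s ->
  run CheckLevels s (6 * n + 3) (fun s' => frame [:: aI; aFlag] [::] s s' /\
    (nmem s' aFlag 0 != 0) =
      [forall e, level_ok (nmem s aK 0) (nmem s aBound) (nmem s aCnt) (part e)]).
Proof.
move=> [eN eM eP].
apply: (@run_le _ _ _ (1 + (n * (4 + 2) + 2))); last by lia.
apply: run_seq; apply: run_setn; set s1 := setn _ _ _ _.
set ok := level_ok _ _ _.
pose I i s' := frame [:: aI; aFlag] [::] s s' /\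
   (nmem s' aFlag 0 != 0) = [forall e : E, (enum_rank e < i) ==> ok (part e)].
apply: run_post (run_for (I := I) (N := n) (tau := 4) _ _ _) _.
- split; first by do 2!apply: frame_setn => //.
  by rewrite /= /update /=; apply/esym/forallP.
- by move=> i s' _ _ [[fr _] _]; rewrite /= fr //= eN.
- move=> i s' iN ei [fr et]; have [frn _] := fr.
  pose e := enum_val (Ordinal iN); have ri : enum_rank e = i :> nat by rewrite enum_valK.
  have ep : neval s' (NCell aPart (V aI)) = part e by rewrite /= ei frn // -ri eP.
  have ek : neval s' (V aK) = nmem s aK 0 by rewrite /= frn.
  have eb : neval s' (NCell aBound (NCell aPart (V aI))) = nmem s aBound (part e).
    by rewrite -ep /= frn.
  have ec : neval s' (NCell aCnt (NCell aPart (V aI))) = nmem s aCnt (part e).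
    by rewrite -ep /= frn.
  have step : [forall e : E, (enum_rank e < i.+1) ==> ok (part e)] =
      (nmem s' aFlag 0 != 0) && ok (part e).
    rewrite et; apply/forallP/andP => [H|[/forallP H oke] e'].
      split; last by have := H e; rewrite ri ltnSn.
      by apply/forallP => e'; apply/implyP => lt; have /implyP := H e'; apply; apply: ltnW.
    apply/implyP; rewrite ltnS leq_eqVlt => /orP[/eqP er|er]; last by have /implyP := H e'; apply.
    by have -> : e' = e by apply: enum_rank_inj; apply: val_inj; rewrite /= er.
  have bad b : ok (part e) = false -> 1 <= b ->
      run (SetN aFlag 0 0) s' b (fun s'0 => nmem s'0 aI 0 = i /\ I i.+1 (setn s'0 aI 0 i.+1)).
    move=> nok b1; apply: run_le (_ : 1 <= b) => //; apply: run_setn; split=> //; split.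
      by do 2!apply: frame_setn => //.
    by rewrite step nok andbF /= /update.
  have good b : ok (part e) -> 1 <= b ->
      run Skip s' b (fun s'0 => nmem s'0 aI 0 = i /\ I i.+1 (setn s'0 aI 0 i.+1)).
    move=> isok b1; apply: run_le (_ : 1 <= b) => //; apply: run_skip; split=> //; split.
      exact: frame_setn.
    by rewrite step isok andbT /= /update.
  have tle x y : teval s' (TLeN x y) = (neval s' x <= neval s' y) by [].
  have tdist x y : neval s' (dist x y) = (neval s' x - neval s' y) + (neval s' y - neval s' x) by [].
  apply: (@run_if _ _ _ _ _ _ _ 3); rewrite tle ep ek.
  case: leqP => pk; last first.
    by apply: good => //; rewrite /ok /level_ok ltnNge (ltnW pk) /=; rewrite gtn_eqF.
  apply: (@run_if _ _ _ _ _ _ _ 2); rewrite tle ep ek.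
  case: leqP => kp.
    have epk : (part e : nat) = nmem s aK 0 by apply/eqP; rewrite eqn_leq pk.
    apply: (@run_if _ _ _ _ _ _ _ 1); rewrite tle eb ec.
    case: leqP => h; [apply: bad|apply: good] => //.
      by rewrite /ok /level_ok epk ltnn eqxx /= ltnNge -epk h.
    by rewrite /ok /level_ok epk ltnn eqxx /= -epk h.
  apply: (@run_if _ _ _ _ _ _ _ 1); rewrite tle tdist eb ec.
  have okE : ok (part e) = (nmem s aCnt (part e) == nmem s aBound (part e)).
    by rewrite /ok /level_ok kp (ltn_eqF kp) /= andbT.
  case: leqP => h; [apply: good|apply: bad] => //; rewrite okE; move: h; rewrite /=.
    by move=> h; apply/eqP; lia.
  by move=> h; apply/eqP; lia.
- move=> s' [_ [fr ->]]; split=> //; apply: eq_forallb => e; by rewrite rank_lt.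
Qed.

End Loops.

(** * Simulation of the intersection algorithm *)

(** The answer to a query, as [Query] would store it: e and 1 if the set has |E|
    slots and the flag is up, else 0 and 0. *)
Definition Verdict (e : rexp) (y z : nat) : cmd :=
  If (TLeN (NAdd (dist (V aTot) (V aN)) (NSub 1 (V aFlag))) 0)
    (Seq (SetR (sh y) 0 e) (SetN (sh z) 0 1))
    (Seq (SetR (sh y) 0 (ROfNat 0)) (SetN (sh z) 0 0)).

Definition QueryObjective (a y z : nat) : cmd :=
  Seq (Total (sh a))
    (Seq (Weight (sh a))
      (Seq (Query 0 (sh a) rVal aFlag)
        (Verdict (RAdd (RCell rVal 0) (RMul (RCell rEps 0) (RCell rAcc 0))) y z))).

Definition QueryConstraint (a y z : nat) : cmd :=
  Seq (Total (sh a))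
    (Seq (ClearLevels aCnt)
      (Seq (AddLevels (sh a) aCnt)
        (Seq CheckLevels (Verdict (ROfNat 0) y z)))).

Fixpoint sh_nexp (e : nexp) : nexp :=
  match e with
  | NConst k => NConst k
  | NCell a i => NCell (sh a) (sh_nexp i)
  | NAdd e1 e2 => NAdd (sh_nexp e1) (sh_nexp e2)
  | NSub e1 e2 => NSub (sh_nexp e1) (sh_nexp e2)
  end.

Fixpoint sh_rexp (e : rexp) : rexp :=
  match e with
  | ROfNat e => ROfNat (sh_nexp e)
  | RCell a i => RCell (sh a) (sh_nexp i)
  | RAdd e1 e2 => RAdd (sh_rexp e1) (sh_rexp e2)
  | RSub e1 e2 => RSub (sh_rexp e1) (sh_rexp e2)
  | RMul e1 e2 => RMul (sh_rexp e1) (sh_rexp e2)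
  | RDiv e1 e2 => RDiv (sh_rexp e1) (sh_rexp e2)
  end.

Fixpoint sh_test (b : test) : test :=
  match b with
  | TLeN e1 e2 => TLeN (sh_nexp e1) (sh_nexp e2)
  | TLeR e1 e2 => TLeR (sh_rexp e1) (sh_rexp e2)
  | TNot b => TNot (sh_test b)
  end.

Fixpoint compile (c : cmd) : cmd :=
  match c with
  | Skip => Skip
  | SetN a i e => SetN (sh a) (sh_nexp i) (sh_nexp e)
  | SetR a i e => SetR (sh a) (sh_nexp i) (sh_rexp e)
  | Seq c1 c2 => Seq (compile c1) (compile c2)
  | If b c1 c2 => If (sh_test b) (compile c1) (compile c2)
  | While b c => While (sh_test b) (compile c)
  | Query q a y z => if q == 0 then QueryObjective a y z else QueryConstraint a y z
  end.

Section Simulation.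
Variables (R : realType) (m : nat) (E : finType) (P : {set {set E}}) (g : {set E} -> R).
Variables (part : E -> 'I_m) (k : nat) (bd : nat -> nat) (eps : R).
Hypothesis km : k < m.
Implicit Types (s S : state R).
Local Notation n := (#|E|).
Local Notation run := (run (fun _ => extend P g)).
Local Notation lev := (level (fun e => part e : nat)).

Definition tempN := [:: aI; aTot; aCnt; aFlag].
Definition tempR := [:: rVal; rAcc].

(** Like [frame], but silent about the arrays of the intersection algorithm. *)
Definition keep (ns rs : seq nat) S S' : Prop :=
  (forall a i, a < 24 -> a \notin ns -> nmem S' a i = nmem S a i) /\
  (forall a i, a < 24 -> a \notin rs -> rmem S' a i = rmem S a i).

Local Notation own := (keep tempN tempR).

Lemma keep_trans ns rs S1 S2 S3 : keep ns rs S1 S2 -> keep ns rs S2 S3 -> keep ns rs S1 S3.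
Proof. by move=> [n1 r1] [n2 r2]; split=> a i h h'; rewrite ?n2 ?n1 ?r2 ?r1. Qed.

(** What the simulated queries read, besides the queried set. *)
Definition ctx S : Prop :=
  [/\ static part S, forall i, i < m -> rmem S rPow i = (n.+1 ^ i)%:R%R,
      nmem S aK 0 = k, forall c, c < m -> nmem S aBound c = bd c
    & rmem S rEps 0 = eps].

Lemma ctx_own S S' : own S S' -> ctx S -> ctx S'.
Proof.
move=> [on or] [[e0 e1 e2] ep ek eb ee]; split; rewrite ?on ?or //.
- by split; rewrite ?on // => e; rewrite on.
- by move=> i im; rewrite or // ep.
- by move=> c cm; rewrite on // eb.
Qed.

Definition sim s S : Prop :=
  (forall a i, nmem S (sh a) i = nmem s a i) /\ (forall a i, rmem S (sh a) i = rmem s a i).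

Lemma sh_eq a b : (sh a == sh b) = (a == b). Proof. by []. Qed.

Lemma sh_own a b : b < 24 -> (sh a == b) = false.
Proof. by do 24![case: b => [|b]; first by []]; rewrite !ltnS. Qed.

Lemma own_sh a b : b < 24 -> (b == sh a) = false.
Proof. by rewrite eq_sym; apply: sh_own. Qed.

Lemma sim_nexp s S e : sim s S -> neval S (sh_nexp e) = neval s e.
Proof.
by move=> [sn _]; elim: e => //= [a e ->|e1 -> e2 ->|e1 -> e2 ->].
Qed.

Lemma sim_rexp s S e : sim s S -> reval S (sh_rexp e) = reval s e.
Proof.
move=> H; elim: e => //= [e|a i|e1 -> e2 ->|e1 -> e2 ->|e1 -> e2 ->|e1 -> e2 ->] //.
  by rewrite (sim_nexp _ H).
by rewrite (proj2 H) (sim_nexp _ H).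
Qed.

Lemma sim_test s S b : sim s S -> teval S (sh_test b) = teval s b.
Proof.
by move=> H; elim: b => //= [e1 e2|e1 e2|b ->]; rewrite ?(sim_nexp _ H) ?(sim_rexp _ H).
Qed.

Lemma sim_setn s S a i v : sim s S -> sim (setn s a i v) (setn S (sh a) i v).
Proof. by move=> [sn sr]; split=> a' i' //=; rewrite /update sh_eq; case: ifP. Qed.

Lemma sim_setr s S a i v : sim s S -> sim (setr s a i v) (setr S (sh a) i v).
Proof. by move=> [sn sr]; split=> a' i' //=; rewrite /update sh_eq; case: ifP. Qed.

Lemma keep_setn ns rs S0 S a i v : keep ns rs S0 S -> (a < 24) ==> (a \in ns) ->
  keep ns rs S0 (setn S a i v).
Proof.
move=> [on or] h; split=> // a' i' lt nt; rewrite /= /update.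
case: eqVneq => [e|_] /=; last exact: on.
by move: nt; rewrite e (implyP h) // -e.
Qed.

Lemma keep_setr ns rs S0 S a i v : keep ns rs S0 S -> (a < 24) ==> (a \in rs) ->
  keep ns rs S0 (setr S a i v).
Proof.
move=> [on or] h; split=> // a' i' lt nt; rewrite /= /update.
case: eqVneq => [e|_] /=; last exact: or.
by move: nt; rewrite e (implyP h) // -e.
Qed.

Lemma frame_sim s S S' : frame tempN tempR S S' -> sim s S -> sim s S' /\ own S S'.
Proof.
move=> [fn fr] [sn sr]; split; last by split=> a i _ h; [apply: fn|apply: fr].
by split=> a i; rewrite ?fn ?fr.
Qed.

(** Dummies get level m, above all k, where no condition is imposed. *)
Definition slot_level (u : 'I_(n + n)) : nat :=
  match split u with inl i => part (enum_val i) | inr _ => m end.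

Lemma slot_level_elt e : slot_level (elt e) = part e.
Proof. by rewrite /slot_level -[elt e]/(unsplit (inl (enum_rank e))) unsplitK enum_rankK. Qed.

Lemma slot_level_dummy (j : 'I_n) : slot_level (dummy j) = m.
Proof. by rewrite /slot_level -[dummy j]/(unsplit (inr j)) unsplitK. Qed.

Lemma level_slot c (Z : {set 'I_(n + n)}) : c < m ->
  level slot_level c Z = lev c (proj Z).
Proof.
move=> cm; rewrite /level card_slots.
have -> : dummies [set z in Z | slot_level z == c] = set0 :> {set 'I_n}.
  apply/setP => j; rewrite !inE slot_level_dummy.
  by rewrite [m == c]gtn_eqF // andbF.
rewrite cards0 addn0; congr #|pred_of_set _|; apply/setP => e.
by rewrite !inE slot_level_elt.
Qed.

Lemma in_cut_slot (Z : {set 'I_(n + n)}) :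
  in_cut slot_level k bd Z = in_cut (fun e => part e : nat) k bd (proj Z).
Proof.
rewrite /in_cut level_slot //; congr (_ && _); apply: eq_forallb => c.
by rewrite level_slot // (ltn_trans _ km).
Qed.

Lemma proj_array_set (f : nat -> nat) : proj (array_set 'I_(n + n) f) = array_set E f.
Proof. by apply/setP => e; rewrite inE array_set_ord inE. Qed.

Definition w_objective := on_family (lift_family P) (tilted g part eps \o @proj E).
Definition w_constraint : {set 'I_(n + n)} -> \bar R :=
  on_family (lex_cut_family slot_level n k bd) (fun=> 0%R).

(** The cuts that are visited satisfy these conditions, which make the test over
    the elements equivalent to membership in the cut. *)
Hypothesis bd0 : forall c, c < k -> (forall e, (part e : nat) != c) -> bd c = 0.
Hypothesis bdk : 0 < bd k.

Lemma level_ok_in_cut (cnt : nat -> nat) (X : {set E}) : (forall e, cnt (part e) = lev (part e) X) ->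
  [forall e, level_ok k bd cnt (part e)] = in_cut (fun e => part e : nat) k bd X.
Proof.
move=> ec; apply/forallP/in_cutP => [H|[H1 H2] e]; last first.
  apply/andP; split; apply/implyP; rewrite ec; first by move=> /H1 ->.
  by move=> /eqP ->.
have empty c : (forall e, (part e : nat) != c) -> lev c X = 0.
  by move=> ne; apply/eqP; rewrite /level cards_eq0; apply/eqP/setP => e; rewrite !inE (negbTE (ne e)) andbF.
have occ c : (exists e, (part e : nat) = c) \/ (forall e, (part e : nat) != c).
  have [/existsP[e /eqP]|] := boolP [exists e, (part e : nat) == c]; first by left; exists e.
  by rewrite negb_exists => /forallP; right.
split=> [c ck|].
  have [[e ee]|ne] := occ c; last by rewrite empty // bd0.
  by have /andP[/implyP + _] := H e; rewrite ec ee => /(_ ck)/eqP.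
have [[e ee]|ne] := occ k; last by rewrite empty.
by have /andP[_ /implyP] := H e; rewrite ec ee eqxx => /(_ isT).
Qed.

Lemma run_verdict e y z s S v (ok : bool) b :
  sim s S -> nmem S aN 0 = n -> ok = (nmem S aTot 0 == n) && (nmem S aFlag 0 != 0) ->
  (ok -> reval S e = v) -> 3 <= b ->
  run (Verdict e y z) S b (fun S' =>
     sim (setn (setr s y 0 (if ok then v else 0%R)) z 0 ok) S' /\ own S S').
Proof.
move=> H eN eok ev b3; apply: run_le b3; apply: run_if => /=.
have -> : ((nmem S aTot 0 - nmem S aN 0 + (nmem S aN 0 - nmem S aTot 0) +
         (1 - nmem S aFlag 0)) <= 0) = ok.
  by rewrite eok eN; lia.
case: {eok}ok ev => ev; apply: (@run_seq _ _ _ 1 1); apply: run_setr; apply: run_setn; split.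
- by rewrite ev //; apply/sim_setn/sim_setr.
- by apply: keep_setn => //; apply: keep_setr.
- exact/sim_setn/sim_setr.
- by apply: keep_setn => //; apply: keep_setr.
Qed.

Lemma fine_on_family (F : finType) (B : {set {set F}}) (h : {set F} -> R) Z :
  fine (on_family B h Z) = if Z \in B then h Z else 0%R.
Proof. by rewrite /on_family; case: ifP. Qed.

Lemma fin_num_on_family (F : finType) (B : {set {set F}}) (h : {set F} -> R) Z :
  (on_family B h Z \is a fin_num) = (Z \in B).
Proof. by rewrite /on_family; case: ifP. Qed.

Definition answer s a y z (w : {set 'I_(n + n)} -> \bar R) : state R :=
  let v := w (array_set 'I_(n + n) (nmem s a)) in
  setn (setr s y 0 (fine v)) z 0 (v \is a fin_num).

Lemma run_query_objective a y z s S : ctx S -> sim s S ->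
  run (QueryObjective a y z) S (11 * n + 10) (fun S' =>
    sim (answer s a y z w_objective) S' /\ own S S').
Proof.
move=> cS sS; have [st ep ek eb ee] := cS; have [eN _ _] := st.
have eA : array_set 'I_(n + n) (nmem S (sh a)) = array_set 'I_(n + n) (nmem s a).
  by apply/setP => i; rewrite !array_set_ord (proj1 sS).
have eX : array_set E (nmem S (sh a)) = proj (array_set 'I_(n + n) (nmem s a)).
  by rewrite -eA proj_array_set.
apply: (@run_le _ _ _ ((6 * n + 3) + ((4 * n + 3) + (n.+1 + 3)))); last by lia.
apply: run_seq; apply: run_post (run_total _ _ _ eN) _; rewrite ?sh_own // => S1 [f1 e1].
have [n1 r1] := f1.
have fr1 : frame tempN tempR S S1 by apply: frame_weak f1 _ _.
have [s1 o1] := frame_sim fr1 sS; have [st1 ep1 _ _ ee1] := ctx_own o1 cS.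
apply: run_seq; apply: run_post (run_weight _ _ st1 ep1) _; rewrite ?sh_own // => S2 [f2 e2].
have fr2 : frame tempN tempR S1 S2 by apply: frame_weak f2 _ _.
have [n2 r2] := f2.
have [s2 o2] := frame_sim fr2 s1; have [[eN2 _ _] _ _ _ ee2] := ctx_own o2 (ctx_own o1 cS).
apply: run_seq; apply: run_query; cbv zeta.
have eX1 : array_set E (nmem S1 (sh a)) = proj (array_set 'I_(n + n) (nmem s a)).
  by rewrite -eX; apply/setP => e; rewrite !in_array_set n1.
have -> : array_set E (nmem S2 (sh a)) = proj (array_set 'I_(n + n) (nmem s a)).
  by rewrite -eX1; apply/setP => e; rewrite !in_array_set n2.
set Z := array_set _ (nmem s a) in eA eX eX1 *; set S3 := setn _ _ _ _.
have fr3 : frame tempN tempR S2 S3 by apply: frame_setn => //; apply: frame_setr.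
have [s3 o3] := frame_sim fr3 s2.
apply: run_post (run_verdict (ok := Z \in lift_family P) (v := tilted g part eps (proj Z)) _ _ s3 _ _ _ _) _ => //.
- rewrite inE /S3 !nmem_setn nmem_setr /= n2 // e1 eA /extend -/Z.
  by congr (_ && _); case: (proj Z \in P).
- rewrite inE => /andP[_ ZP].
  have eR1 : rmem S3 rVal 0 = g (proj Z) by rewrite /S3 /= /update /= /extend ZP.
  have eR2 : rmem S3 rEps 0 = eps by rewrite -ee2.
  have eR3 : rmem S3 rAcc 0 = rmem S2 rAcc 0 by [].
  by clearbody S3; rewrite /= eR1 eR2 eR3 e2 eX1.
move=> S' [s' o']; split; last exact: keep_trans o1 (keep_trans o2 (keep_trans o3 o')).
by rewrite /answer -/Z /w_objective fine_on_family fin_num_on_family.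
Qed.

Lemma run_query_constraint a y z s S : ctx S -> sim s S ->
  run (QueryConstraint a y z) S (18 * n + 13) (fun S' =>
    sim (answer s a y z w_constraint) S' /\ own S S').
Proof.
move=> cS sS; have [st ep ek eb ee] := cS; have [eN _ _] := st.
have eA : array_set 'I_(n + n) (nmem S (sh a)) = array_set 'I_(n + n) (nmem s a).
  by apply/setP => i; rewrite !array_set_ord (proj1 sS).
have eX : array_set E (nmem S (sh a)) = proj (array_set 'I_(n + n) (nmem s a)).
  by rewrite -eA proj_array_set.
apply: (@run_le _ _ _ ((6 * n + 3) + ((3 * n + 2) + ((3 * n + 2) + ((6 * n + 3) + 3))))); last by lia.
apply: run_seq; apply: run_post (run_total _ _ _ eN) _; rewrite ?sh_own // => S1 [f1 e1].
have fr1 : frame tempN tempR S S1 by apply: frame_weak f1 _ _.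
have [n1 r1] := f1.
have [s1 o1] := frame_sim fr1 sS; have [st1 _ _ _ _] := ctx_own o1 cS.
apply: run_seq; apply: run_post (run_clear_levels (d := aCnt) _ _ _ _ st1) _ => // S2 [f2 e2].
have fr2 : frame tempN tempR S1 S2 by apply: frame_weak f2 _ _.
have [n2 r2] := f2.
have [s2 o2] := frame_sim fr2 s1; have [st2 _ _ _ _] := ctx_own o2 (ctx_own o1 cS).
apply: run_seq; apply: run_post (run_add_levels (d := aCnt) _ _ _ _ _ _ st2) _; rewrite ?sh_own // => S3 [f3 e3].
have fr3 : frame tempN tempR S2 S3 by apply: frame_weak f3 _ _.
have [n3 r3] := f3.
have [s3 o3] := frame_sim fr3 s2; have c3 := ctx_own o3 (ctx_own o2 (ctx_own o1 cS)).
have [st3 _ ek3 eb3 _] := c3.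
apply: run_seq; apply: run_post (run_check_levels _ st3) _ => S4 [f4 e4].
have fr4 : frame tempN tempR S3 S4 by apply: frame_weak f4 _ _.
have [n4 r4] := f4.
have [s4 o4] := frame_sim fr4 s3; have [[eN4 _ _] _ _ _ _] := ctx_own o4 c3.
have eX2 : array_set E (nmem S2 (sh a)) = proj (array_set 'I_(n + n) (nmem s a)).
  by rewrite -eX; apply/setP => e; rewrite !in_array_set n2 ?n1.
set Z := array_set _ (nmem s a) in eA eX eX2.
apply: run_post (run_verdict (ok := Z \in lex_cut_family slot_level n k bd) (v := 0%R) _ _ s4 _ _ _ _) _ => //.
  rewrite inE n4 // n3 // n2 // e1 eA -/Z e4 ek3 in_cut_slot; congr (_ && _).
  rewrite -(@level_ok_in_cut (nmem S3 aCnt)).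
    by apply: eq_forallb => e; rewrite /level_ok eb3.
  by move=> e; rewrite e3 e2 add0n eX2.
move=> S' [s' o']; split; last exact: keep_trans o1 (keep_trans o2 (keep_trans o3 (keep_trans o4 o'))).
by rewrite /answer -/Z /w_constraint fine_on_family fin_num_on_family.
Qed.

(** The factor 13 covers the cost 18 |E| + 13 of a simulated query, against 2|E| + 1. *)
Lemma compile_correct c s s' t :
  exec (vmi_oracle w_objective w_constraint) c s s' t ->
  forall S, ctx S -> sim s S ->
  run (compile c) S (13 * t) (fun S' => sim s' S' /\ own S S').
Proof.
elim => {c s s' t}.
- by move=> s S cS sS; apply: (@run_le _ _ _ 1) => //; apply: run_skip.
- move=> a i e s S cS sS; apply: (@run_le _ _ _ 1) => //; apply: run_setn.
  by rewrite !(sim_nexp _ sS); split; [apply: sim_setn|apply: keep_setn].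
- move=> a i e s S cS sS; apply: (@run_le _ _ _ 1) => //; apply: run_setr.
  by rewrite !(sim_nexp _ sS) (sim_rexp _ sS); split; [apply: sim_setr|apply: keep_setr].
- move=> c1 c2 s s1 s2 t1 t2 _ IH1 _ IH2 S cS sS; rewrite mulnDr; apply: run_seq.
  apply: run_post (IH1 S cS sS) _ => S1 [sS1 o1].
  apply: run_post (IH2 S1 (ctx_own o1 cS) sS1) _ => S2 [sS2 o2].
  by split=> //; apply: keep_trans o2.
- move=> b c1 c2 s s' t _ IH S cS sS /=.
  apply: (@run_le _ _ _ (13 * t).+1); last by lia.
  apply: run_if; rewrite (sim_test _ sS); have := IH S cS sS.
  by case: (teval s b).
- move=> b c s nb S cS sS; exists S, 1; split=> //.
  by apply: ExecWhileStop; rewrite (sim_test _ sS).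
- move=> b c s s1 s2 t1 t2 tb _ IH1 _ IH2 S cS sS.
  have [S1 [u1 [ex1 le1 [sS1 o1]]]] := IH1 S cS sS.
  have [S2 [u2 [ex2 le2 [sS2 o2]]]] := IH2 S1 (ctx_own o1 cS) sS1.
  exists S2, (u1 + u2).+1; split.
  + by apply: ExecWhileStep ex1 ex2; rewrite (sim_test _ sS).
  + by lia.
  + by split=> //; apply: keep_trans o2.
- move=> q a y z s v S cS sS; rewrite card_ord /= /v /vmi_oracle.
  case: ifP => _.
    by apply: run_le (run_query_objective a y z cS sS) _; move: n; clear; lia.
  by apply: run_le (run_query_constraint a y z cS sS) _; move: n; clear; lia.
Qed.

End Simulation.
Notation own := (keep tempN tempR).

(** * Solving one intersection problem *)

(** Stores a set of elements given by its indicator e, together with as many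
    dummies as there are elements outside it; this is the set [embed X]. *)
Definition Spread (z : nat) (e : nexp) : cmd :=
  For aI (V aN)
    (Seq (SetN (sh z) (V aI) e) (SetN (sh z) (NAdd (V aN) (V aI)) (NSub 1 e))).

(** Indicator of the elements of the last listed set whose levels are below k.  They
    form a feasible set for the constraint side: level k is empty there. *)
Definition kept : nexp :=
  NSub (NAdd (indicator (NCell aSet (V aI))) (indicator (NSub (V aK) (NCell aPart (V aI))))) 1.

Definition Solve (vmi : cmd) : cmd :=
  Seq (SetN (sh 0) 0 (NAdd (V aN) (V aN)))
    (Seq (Spread 1 (NCell aInit (V aI)))
      (Seq (Spread 2 kept) (compile vmi))).

Section Embed.
Variable E : finType.
Local Notation n := (#|E|).
Implicit Types (X : {set E}).

Definition embed X : {set 'I_(n + n)} :=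
  [set u | match split u with inl i => enum_val i \in X | inr j => enum_val j \notin X end].

Lemma elt_embed e X : (elt e \in embed X) = (e \in X).
Proof. by rewrite inE -[elt e]/(unsplit (inl (enum_rank e))) unsplitK enum_rankK. Qed.

Lemma dummy_embed (j : 'I_n) X : (dummy j \in embed X) = (enum_val j \notin X).
Proof. by rewrite inE -[dummy j]/(unsplit (inr j)) unsplitK. Qed.

Lemma proj_embed X : proj (embed X) = X.
Proof. by apply/setP => e; rewrite inE elt_embed. Qed.

Lemma card_embed X : #|embed X| = n.
Proof.
rewrite card_slots proj_embed -[RHS](cardsC X); congr (_ + _).
have -> : dummies (embed X) = [set enum_rank e | e in ~: X] :> {set 'I_n}.
  apply/setP => j; rewrite inE dummy_embed -[j in RHS]enum_valK mem_imset ?inE //.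
  exact: enum_rank_inj.
by rewrite card_imset //; apply: enum_rank_inj.
Qed.

End Embed.

Section SolveSpec.
Variables (R : realType) (vmi : cmd) (T : nat -> nat).
Hypothesis solves : solves_VMI R vmi T.
Variables (m : nat) (E : finType) (P : {set {set E}}) (g : {set E} -> R).
Variables (part : E -> 'I_m).
Hypothesis exP : exchange P g.
Implicit Types (s S : state R).
Local Notation n := (#|E|).
Local Notation run := (run (fun _ => extend P g)).
Local Notation cl := (fun e => part e : nat).
Local Notation lev := (level cl).

Lemma run_spread z e (X : {set E}) S : z < 3 -> nmem S aN 0 = n ->
  (forall (i : E) S', frame [:: aI; sh z] [::] S S' -> nmem S' aI 0 = enum_rank i ->
     (neval S' e != 0) = (i \in X)) ->
  run (Spread z e) S (4 * n + 2) (fun S' => frame [:: aI; sh z] [::] S S' /\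
    array_set 'I_(n + n) (nmem S' (sh z)) = embed X).
Proof.
move=> z3 eN He.
apply: (@run_le _ _ _ (n * ((1 + 1) + 2) + 2)); last by lia.
pose I i S' := frame [:: aI; sh z] [::] S S' /\
   forall x : E, enum_rank x < i -> (nmem S' (sh z) (enum_rank x) != 0) = (x \in X) /\
      (nmem S' (sh z) (n + enum_rank x) != 0) = (x \notin X).
apply: run_post (run_for (I := I) (N := n) (tau := 1 + 1) _ _ _) _.
- by split=> //; apply: frame_setn.
- by move=> i S' _ _ [[fr _] _]; rewrite /= fr.
- move=> i S' iN ei [fr et]; have [frn _] := fr.
  pose x := enum_val (Ordinal iN); have rx : enum_rank x = i :> nat by rewrite enum_valK.
  apply: run_seq; apply: run_setn; apply: run_setn.
  set S1 := setn S' _ _ _; set S2 := setn S1 _ _ _.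
  have fr1 : frame [:: aI; sh z] [::] S S1 by apply: frame_setn => //; rewrite !inE eqxx.
  have fr2 : frame [:: aI; sh z] [::] S S2 by apply: frame_setn => //; rewrite !inE eqxx.
  have e1 : neval S1 (NAdd (V aN) (V aI)) = n + i.
    have -> : neval S1 (NAdd (V aN) (V aI)) = nmem S1 aN 0 + nmem S1 aI 0 by [].
    by rewrite fr1.1 // eN [nmem S1 aI 0]ei.
  have v1 : (neval S' e != 0) = (x \in X) by apply: He; rewrite // ei rx.
  have v2 : (neval S1 (NSub 1 e) != 0) = (x \notin X).
    have := He x S1 fr1; rewrite [nmem S1 aI 0]ei rx => <- //.
    by rewrite [neval _ _]/=; case: (neval S1 e).
  have eS2 r : nmem S2 (sh z) r = if r == n + i then neval S1 (NSub 1 e)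
      else if r == i then neval S' e else nmem S' (sh z) r.
    by rewrite [LHS]nmem_setn e1 eqxx /=; case: ifP => // _; rewrite [LHS]nmem_setn /= ei eqxx.
  split; first exact: ei.
  split; first exact: frame_setn.
  move=> y yi.
  suff : (nmem S2 (sh z) (enum_rank y) != 0) = (y \in X) /\
      (nmem S2 (sh z) (n + enum_rank y) != 0) = (y \notin X) by [].
  rewrite !eS2.
  have ylt := rank_lt y; rewrite eqn_add2l.
  have -> : (enum_rank y == n + i :> nat) = false by apply/eqP; lia.
  have -> : (n + enum_rank y == i :> nat) = false by apply/eqP; lia.
  move: yi; rewrite ltnS leq_eqVlt => /orP[/eqP yi|yi]; last first.
    by rewrite (ltn_eqF yi); apply: et.
  rewrite yi eqxx; have -> : y = x by apply: enum_rank_inj; apply: val_inj; rewrite /= yi.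
  by split; [exact: v1|exact: v2].
- move=> S' [_ [fr et]]; split=> //; apply/setP => u; rewrite array_set_ord.
  case: (slotP u) => [x|j]; first by rewrite elt_embed (et x (rank_lt x)).1.
  rewrite dummy_embed -(et _ (rank_lt (enum_val j))).2.
  by rewrite enum_valK.
Qed.

Lemma tilted_exchange eps : exchange P (tilted g part eps).
Proof.
have e X : tilted g part eps X = tilt g (fun e => eps * (n.+1 ^ (m.-1 - part e))%:R)%R X.
  by rewrite /tilted /tilt /lex_weight natr_sum mulr_sumr.
move=> X Y u XP YP uXY; have := exchange_tilt (fun e => eps * (n.+1 ^ (m.-1 - part e))%:R)%R exP XP YP uXY.
case=> [[? ? le]|[v vYX [? ? le]]]; [left|right; exists v => //]; split=> //; by rewrite !e.
Qed.

Definition solved S k bd eps : Prop :=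
  (nmem S (sh 3) 0 = 0 /\ forall X, X \in P -> ~~ in_cut cl k bd X) \/
  (nmem S (sh 3) 0 <> 0 /\ let X := array_set E (nmem S (sh 4)) in
     [/\ X \in P, in_cut cl k bd X & forall Y, Y \in P -> in_cut cl k bd Y ->
        (tilted g part eps X <= tilted g part eps Y)%R]).

(** The lower bound on T pays for the preparation of the two initial sets. *)
Lemma run_solve k bd eps S : k < m -> ctx part k bd eps S ->
  array_set E (nmem S aInit) \in P ->
  (forall c, c < k -> bd c = lev c (array_set E (nmem S aSet))) -> 0 < bd k ->
  run (Solve vmi) S (18 * T (n + n)) (fun S' => own S S' /\ solved S' k bd eps).
Proof.
move=> km cS initP bdA bk.
have T1 := vmi_time_lower_bound solves n.
apply: (@run_le _ _ _ (1 + ((4 * n + 2) + ((4 * n + 2) + 13 * T (n + n))))); last first.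
  by move: T1; move: (T _) => t; move: n; clear; lia.
have [[eN eM eP] ep ek eb ee] := cS.
set X0 := array_set E (nmem S aInit) in initP.
set A := array_set E (nmem S aSet) in bdA.
apply: run_seq; apply: run_setn; set S1 := setn S _ _ _.
have o1 : own S S1 by apply: keep_setn.
apply: run_seq; apply: run_post (@run_spread 1 _ X0 S1 _ _ _) _ => //.
  move=> i S' [fr _] ei; rewrite [neval _ _]/= ei fr //.
  by rewrite in_array_set.
move=> S2 [f2 e2].
have o2 : own S1 S2.
  split=> a i lt nt; [apply: f2.1|exact: f2.2].
  by move: nt; rewrite !inE own_sh // orbF !negb_or => /and4P[].
pose B := [set e in A | part e < k].
have ctx2 := ctx_own o2 (ctx_own o1 cS).
have [[eN2 _ eP2] _ ek2 _ _] := ctx2.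
apply: run_seq; apply: run_post (@run_spread 2 _ B S2 _ _ _) _ => //.
  move=> i S' [fr _] ei; rewrite [neval _ _]/= ei !sub1_sub1 !fr // eP2 ek2.
  have -> : nmem S2 aSet (enum_rank i) = nmem S aSet (enum_rank i) by rewrite (proj1 f2).
  rewrite !inE !subn_eq0 -!ltnNge.
  by case: (nmem S _ _ != 0); case: (_ < k).
move=> S3 [f3 e3].
have o3 : own S2 S3.
  split=> a i lt nt; [apply: f3.1|exact: f3.2].
  by move: nt; rewrite !inE own_sh // orbF !negb_or => /and4P[].
have ctx3 := ctx_own o3 ctx2.
pose s : state R := State (fun a => nmem S3 (sh a)) (fun a => rmem S3 (sh a)).
have sims : sim s S3 by [].
pose w1 := w_objective P g part eps; pose w2 := w_constraint R part k bd.
have e2' : array_set 'I_(n + n) (nmem s 1) = embed X0.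
  by rewrite -e2; apply/setP => u; rewrite !array_set_ord /= f3.1.
have inl1 X : X \in P -> embed X \in lift_family P.
  by move=> XP; rewrite inE card_embed eqxx proj_embed.
have inl2 X : in_cut cl k bd X -> embed X \in lex_cut_family (slot_level part) n k bd.
  by move=> Xc; rewrite inE card_embed eqxx in_cut_slot // proj_embed.
have Bc : in_cut cl k bd B.
  apply/in_cutP; split.
    move=> c ck; rewrite bdA // /level; congr #|pred_of_set _|; apply/setP => e; rewrite !inE.
    by case: (eqVneq (part e : nat) c) => [->|]; rewrite ?andbF // ck !andbT.
  rewrite /level eq_card0 // => e; rewrite !inE; apply/negbTE.
  by case: (eqVneq (part e : nat) k) => [->|]; rewrite ?andbF // ltnn !andbF.
have v1 : valuated_matroid w1.
  apply: valuated_lift; last by apply/set0Pn; exists (embed X0); apply: inl1.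
    by apply/set0Pn; exists X0.
  exact: tilted_exchange.
have v2 : valuated_matroid w2.
  by apply: valuated_lex_cut; apply/set0Pn; exists (embed B); apply: inl2.
have d1 : dom w1 = lift_family P by rewrite /w1 /w_objective dom_on_family.
have d2 : dom w2 = lex_cut_family (slot_level part) n k bd.
  by rewrite /w2 /w_constraint dom_on_family.
have inp : vmi_input w1 w2 s.
  split; first by rewrite card_ord /= f3.1 // f2.1 //= eN.
  - by rewrite e2' d1 inl1.
  - by rewrite /= e3 d2 inl2.
have [|s' [t [ex le out]]] := solves (n := n + n) _ v1 v2 inp; first by rewrite card_ord.
have bd0 c : c < k -> (forall e, (part e : nat) != c) -> bd c = 0.
  move=> ck ne; rewrite bdA //; apply/eqP; rewrite /level cards_eq0.
  by apply/eqP/setP => e; rewrite !inE (negbTE (ne e)) andbF.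
apply: (@run_weaken _ _ _ _ _ (13 * t)) (compile_correct km bd0 bk ex ctx3 sims) _ _.
  by rewrite leq_mul2l le orbT.
move=> S' [[sn sr] o4]; split.
  exact: keep_trans o1 (keep_trans o2 (keep_trans o3 o4)).
have eX : array_set E (nmem S' (sh 4)) = proj (array_set 'I_(n + n) (nmem s' 4)).
  by rewrite proj_array_set; apply/setP => e; rewrite !in_array_set sn.
rewrite /solved sn eX; case: out => [[z0 dis]|[nz XD opt]]; [left|right]; split=> //.
  move=> X XP; apply/negP => Xc; move/setP/(_ (embed X)): dis.
  by rewrite inE d1 d2 inl1 // inl2 // inE.
cbv zeta; move: XD; rewrite inE d1 d2 => /andP[X1 X2].
have := X1; have := X2; rewrite 2!inE => /andP[_ Xc] /andP[_ XP].
split=> //; first by rewrite -in_cut_slot.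
move=> Y YP Yc; have := opt (embed Y).
rewrite /w1 /w2 /w_objective /w_constraint /on_family X1 X2 inl1 // inl2 //.
by rewrite -!EFinD lee_fin /= proj_embed !addr0.
Qed.

End SolveSpec.

(** * Scanning the cuts *)

Definition RecordMinimum (gap : rexp) : cmd :=
  Seq (SetR rGap 0 gap)
    (Seq (SetR rMin 0 (RCell rVal 0))
      (Seq (SetN aFound 0 1) (Seq (SetN aImproved 0 1) (SetN aBest 0 (V aK))))).

Definition Try (vmi : cmd) : cmd :=
  Seq (Solve vmi)
    (If (TLeN (NCell (sh 3) 0) 0) Skip
      (Seq (Query 0 (sh 4) rVal aFlag)
        (If (TLeN (V aFound) 0)
          (RecordMinimum (RAdd (RCell rVal 0) (ROfNat 1)))
          (If (TLeR (RCell rMin 0) (RCell rVal 0)) Skip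
            (RecordMinimum (RCell rMin 0)))))).

(** Cuts with a zero bound are empty and are skipped: for them the array aSet need
    not provide a feasible set. *)
Definition Scan (vmi : cmd) : cmd :=
  Seq (SetN aImproved 0 0)
    (Seq (SetR rEps 0 (ROfNat 0))
      (Seq (If (TLeN (V aDepth) 0) (SetN aFound 0 0)
             (Seq (SetR rMin 0 (RCell rStk (NSub (V aDepth) 1))) (SetN aFound 0 1)))
        (For aK (V aM) (If (TLeN (NCell aBound (V aK)) 0) Skip (Try vmi))))).

Definition scratchN := [:: aK; aImproved; aFound; aBest] ++ tempN.
Definition scratchR := [:: rEps; rMin; rGap] ++ tempR.
Notation scratch := (keep scratchN scratchR).

Section Main.
Variables (R : realType) (vmi : cmd) (T : nat -> nat).
Hypothesis solves : solves_VMI R vmi T.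
Variables (m : nat) (E : finType) (P : {set {set E}}) (g : {set E} -> R).
Variable part : E -> 'I_m.
Hypothesis exP : exchange P g.
Implicit Types (s S : state R) (outs stk : seq {set E}) (bd : nat -> nat) (X Y Z : {set E}).
Local Notation n := (#|E|).
Local Notation run := (run (fun _ => extend P g)).
Local Notation cl := (fun e => part e : nat).
Local Notation lev := (level cl).
Local Notation q := (n.+1).
Local Notation t := (T (n + n)).

(** How the memory represents the abstract state of [progress]. *)
Record store outs stk bd s : Prop := Store {
  st_static : static part s;
  st_pow : forall i, i <= m -> rmem s rPow i = (q ^ i)%:R%R;
  st_init : array_set E (nmem s aInit) \in P;
  st_bound : forall c, c < m -> nmem s aBound c = bd c;
  st_ref : forall k c, k < m -> 0 < bd k -> c < k -> bd c = lev c (array_set E (nmem s aSet));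
  st_out : nmem s aOut 0 = size outs;
  st_etapos : nmem s aEtaPos 0 = size outs * m;
  st_outs : forall j, j < size outs -> rmem s rOut j = g (nth set0 outs j) /\
    forall i, i < m -> nmem s aEta (j * m + i) = lev i (nth set0 outs j);
  st_depth : nmem s aDepth 0 = size stk;
  st_stkpos : nmem s aStkPos 0 = size stk * n;
  st_stk : forall j, j < size stk -> rmem s rStk j = g (nth set0 stk j) /\
    forall e, (nmem s aStk (j * n + enum_rank e) != 0) = (e \in nth set0 stk j) }.


Lemma own_scratch s s' : own s s' -> scratch s s'.
Proof.
by move=> [kn kr]; split=> a i lt; rewrite mem_cat negb_or => /andP[_ h]; [apply: kn|apply: kr].
Qed.

Lemma store_keep outs stk bd s s' : scratch s s' -> store outs stk bd s -> store outs stk bd s'.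
Proof.
move=> [kn kr] [[e0 e1 e2] h2 h3 h4 h5 h6 h7 h8 h9 h10 h11].
have as_ a : a < 24 -> a \notin scratchN -> array_set E (nmem s' a) = array_set E (nmem s a).
  by move=> lt nt; apply/setP => e; rewrite !in_array_set kn.
split; rewrite ?kn ?as_ //.
- by split; rewrite ?kn // => e; rewrite kn.
- by move=> i im; rewrite kr // h2.
- by move=> c cm; rewrite kn // h4.
- by move=> j js; have [h8a h8b] := h8 j js; rewrite kr //; split=> // i im; rewrite kn // h8b.
- by move=> j js; have [h8a h8b] := h11 j js; rewrite kr //; split=> // i; rewrite kn // h8b.
Qed.

Lemma store_ctx outs stk bd s k eps : store outs stk bd s -> nmem s aK 0 = k ->
  rmem s rEps 0 = eps -> ctx part k bd eps s.
Proof.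
by case=> h1 h2 _ h4 _ _ _ _ _ _ _ ek ee; split=> // i im; apply: h2; apply: ltnW.
Qed.

Lemma card_lt_time : n < t.
Proof. by apply: leq_trans (vmi_time_lower_bound solves _); rewrite ltnS leq_addr. Qed.

Section Iteration.
Variables (outs stk : seq {set E}) (bd : nat -> nat).

Definition lower_bound_on (ks : pred nat) (v : R) : Prop :=
  forall j Y, ks j -> Y \in P -> in_cut cl j bd Y -> (v <= g Y)%R.

(** After the first k cuts.  In the last clause g has value rMin at a member of the cut
    aBest and is at least rGap on all earlier cuts, because rMin is only replaced by a
    strictly smaller value and its previous value is moved to rGap. *)
Definition scanned k s : Prop :=
  let found := nmem s aFound 0 != 0 in
  let fmin := rmem s rMin 0 in
  let best := nmem s aBest 0 in
  let B := rmem s rGap 0 in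
  [/\ forall j Y, j < k -> Y \in P -> in_cut cl j bd Y -> found /\ (fmin <= g Y)%R,
      stk != [::] -> found /\ (fmin <= g (last set0 stk))%R,
      nmem s aImproved 0 = 0 -> found -> stk != [::] /\ fmin = g (last set0 stk) &
      nmem s aImproved 0 != 0 ->
        [/\ found, best < k, exists X0, [/\ X0 \in P, in_cut cl best bd X0 & g X0 = fmin],
            (fmin < B)%R & lower_bound_on (fun j => j < best) B /\
            (stk != [::] -> (B <= g (last set0 stk))%R)]].

Lemma run_record gap k s b (Q : state R -> Prop) : nmem s aK 0 = k -> 5 <= b ->
  (forall s', scratch s s' -> nmem s' aK 0 = k -> nmem s' aFound 0 = 1 -> nmem s' aImproved 0 = 1 ->
     nmem s' aBest 0 = k -> rmem s' rMin 0 = rmem s rVal 0 -> rmem s' rGap 0 = reval s gap ->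
     rmem s' rEps 0 = rmem s rEps 0 -> Q s') ->
  run (RecordMinimum gap) s b Q.
Proof.
move=> ek b5 H; apply: run_le b5; apply: (@run_seq _ _ _ 1 4); apply: run_setr.
apply: (@run_seq _ _ _ 1 3); apply: run_setr; apply: (@run_seq _ _ _ 1 2); apply: run_setn.
apply: (@run_seq _ _ _ 1 1); apply: run_setn; apply: run_setn; apply: H => //.
by do 3!apply: keep_setn => //; do 2!apply: keep_setr => //.
Qed.

Lemma tilted0 X : tilted g part 0%R X = g X.
Proof. by rewrite /tilted mul0r addr0. Qed.

Lemma run_try k s : k < m -> store outs stk bd s -> nmem s aK 0 = k -> rmem s rEps 0 = 0%R ->
  0 < bd k -> scanned k s ->
  run (Try vmi) s (18 * t + n + 10) (fun s' => [/\ scratch s s', nmem s' aK 0 = k,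
     rmem s' rEps 0 = 0%R & scanned k.+1 s']).
Proof.
move=> km st ek ee bk sc.
apply: (@run_le _ _ _ (18 * t + (n + 10))); last by rewrite addnA.
apply: run_seq; apply: run_post (run_solve solves exP km (store_ctx st ek ee) (st_init st) _ bk) _.
  by move=> c ck; apply: (st_ref st km bk ck).
move=> s1 [o1 sol].
have k1 := own_scratch o1; have [on or] := o1.
have {}sc : scanned k s1 by rewrite /scanned !on ?or //.
have ek1 : nmem s1 aK 0 = k by rewrite on.
have ee1 : rmem s1 rEps 0 = 0%R by rewrite or.
apply: (@run_le _ _ _ (n + 9).+1); last by rewrite (addnS n 9).
apply: run_if; rewrite [teval _ _]/= leqn0; case: sol => [[z nf]|[nz [XP Xc opt]]].
  rewrite z eqxx; apply: run_le (_ : 1 <= _); last by rewrite addnS.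
  apply: run_skip; split=> //; case: sc => a b c d; split=> //.
    move=> j Y; rewrite ltnS leq_eqVlt => /orP[/eqP->|jk] YP Yc; last exact: a jk YP Yc.
    by have := nf Y YP; rewrite Yc.
  by case/d => d1 d2 d3 d4 d5; split=> //; apply: ltnW.
have -> : (nmem s1 (sh 3) 0 == 0) = false by apply/eqP.
set X := array_set _ _ in XP Xc opt.
apply: (@run_le _ _ _ (n.+1 + 8)); last by rewrite addSnnS.
apply: run_seq; apply: run_query; cbv zeta.
rewrite -/X /extend XP; set s2 := setn _ _ _ _.
have k2 : scratch s s2 by apply: keep_trans k1 _; apply: keep_setn => //; apply: keep_setr.
have eV : rmem s2 rVal 0 = g X by [].
have {}ee : rmem s2 rEps 0 = 0%R by rewrite -ee1.
have {}ek : nmem s2 aK 0 = k by rewrite -ek1.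
have {}sc : scanned k s2 := sc.
have {opt}optX Y : Y \in P -> in_cut cl k bd Y -> (g X <= g Y)%R.
  by move=> YP Yc; have := opt Y YP Yc; rewrite !tilted0.
clearbody s2 X; clear s1 on or o1 k1 nz ek1 ee1.
have record gap (B : R) b : 5 <= b -> (g X < B)%R -> lower_bound_on (fun j => j < k) B ->
    (stk != [::] -> (B <= g (last set0 stk))%R) -> reval s2 gap = B ->
    (nmem s2 aFound 0 != 0 -> (g X <= rmem s2 rMin 0)%R) ->
    run (RecordMinimum gap) s2 b (fun s' => [/\ scratch s s', nmem s' aK 0 = k,
     rmem s' rEps 0 = 0%R & scanned k.+1 s']).
  move=> b5 ltB minB stkB eB leM; apply: run_record ek b5 _ => s3 k3 ek3 ef ei eb eM eG eE.
  split=> //; [exact: keep_trans k2 k3|by rewrite eE|].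
  rewrite /scanned ef ei eb eM eG eV eB; case: sc => a b' c d; split=> //.
  - move=> j Y; rewrite ltnS leq_eqVlt => /orP[/eqP->|jk] YP Yc; split=> //; first exact: optX.
    have [f le] := a j Y jk YP Yc; exact: le_trans (leM f) le.
  - by move=> /b'[f le]; split=> //; apply: le_trans (leM f) le.
  - by move=> _; split=> //; exists X.
apply: (@run_le _ _ _ (7.+1)) => //; apply: run_if; rewrite [teval _ _]/= leqn0.
have [a b c d] := sc; case: eqP => ef.
  have s0 : stk = [::] by apply/eqP/negPn/negP => /b[]; rewrite ef.
  apply: (record _ (g X + 1)%R) => //.
  - by rewrite ltrDl.
  - by move=> j Y jk YP Yc; have [] := a j Y jk YP Yc; rewrite ef.
  - by rewrite s0.
  - by rewrite /= eV.
  - by rewrite ef.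
apply: (@run_le _ _ _ (6.+1)) => //; apply: run_if; rewrite [teval _ _]/= eV.
case: leP => le.
  apply: run_le (_ : 1 <= _) => //; apply: run_skip; split=> //; split=> //.
    move=> j Y; rewrite ltnS leq_eqVlt => /orP[/eqP->|jk] YP Yc; last exact: a jk YP Yc.
    split; [exact/eqP|exact: le_trans le (optX Y YP Yc)].
  by case/d => d1 d2 d3 d4 d5; split=> //; apply: ltnW.
apply: (record _ (rmem s2 rMin 0)) => //.
- by move=> j Y jk YP Yc; have [] := a j Y jk YP Yc.
- by move=> /b[].
- by move=> _; apply: ltW.
Qed.

Lemma run_scan s : store outs stk bd s ->
  run (Scan vmi) s (m * (18 * t + n + 13) + 8) (fun s' => [/\ scratch s s' & scanned m s']).
Proof.
move=> st; have eD := st_depth st; have [_ eM _] := st_static st.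
apply: (@run_le _ _ _ (1 + (1 + (3 + (m * ((18 * t + n + 10).+1 + 2) + 2))))); last first.
  by move: (18 * t) => u; move: n m; clear; lia.
apply: run_seq; apply: run_setn; apply: run_seq; apply: run_setr.
set s1 := setr _ _ _ _.
have k1 : scratch s s1 by apply: keep_setr => //; apply: keep_setn.
have st1 := store_keep k1 st.
have i1 : nmem s1 aImproved 0 = 0 by [].
have ee1 : rmem s1 rEps 0 = 0%R by [].
clearbody s1.
apply: run_seq; apply: (@run_post _ _ _ _ _ _ (fun s2 => [/\ scratch s s2, rmem s2 rEps 0 = 0%R & scanned 0 s2])).
  apply: run_if; rewrite [teval _ _]/= (st_depth st1) leqn0 size_eq0.
  have [s0|sn0] := eqVneq stk [::].
    apply: run_le (_ : 1 <= 2) => //; apply: run_setn; split=> //; first exact: keep_setn.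
    by split=> //; [rewrite s0|rewrite [nmem _ aImproved 0]i1].
  apply: (@run_seq _ _ _ 1 1); apply: run_setr; apply: run_setn; set s2 := setn _ _ _ _.
  have eG : rmem s2 rMin 0 = g (last set0 stk).
    rewrite -nth_last.
    have lt : (size stk).-1 < size stk by rewrite prednK // lt0n size_eq0.
    have [<- _] := st_stk st1 lt; rewrite -subn1 -(st_depth st1).
    by [].
  split=> //; first by apply: keep_setn => //; apply: keep_setr.
  by split=> //; rewrite ?eG // [nmem _ aImproved 0]i1.
move=> s2 [k2 ee2 sc2]; have st2 := store_keep k2 st.
pose I k s' := [/\ scratch s s', rmem s' rEps 0 = 0%R & scanned k s'].
apply: run_post (run_for (I := I) (N := m) (tau := (18 * t + n + 10).+1) _ _ _) _.
- by split=> //; apply: keep_setn.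
- by move=> k s3 _ _ [k3 _ _]; have [_ eM3 _] := st_static (store_keep k3 st).
- move=> k s3 km ek [k3 ee3 sc3]; have st3 := store_keep k3 st.
  apply: run_if; rewrite [teval _ _]/= ek (st_bound st3) // leqn0.
  case: posnP => bk.
    apply: run_le (_ : 1 <= _); last by rewrite addnS.
    apply: run_skip; split=> //; split=> //; first exact: keep_setn.
    case: sc3 => a b c d; split=> //.
      move=> j Y; rewrite ltnS leq_eqVlt => /orP[/eqP->|jk] YP; last exact: a jk YP.
      by move=> /in_cutP[_]; rewrite bk.
    by case/d => d1 d2 d3 d4 d5; split=> //; apply: ltnW.
  apply: run_post (run_try km st3 ek ee3 bk sc3) _ => s4 [k4 ek4 ee4 sc4].
  split=> //; split=> //; apply: keep_setn => //; exact: keep_trans k3 k4.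
- by move=> s3 [_ [k3 _ sc3]].
Qed.

End Iteration.
End Main.

(** * Pushing and popping a Pareto optimal set *)

Definition Copy (bnd : nexp) (d : nat) (de : nexp) (z : nat) (ze : nexp) : cmd :=
  For aI bnd (SetN d (NAdd de (V aI)) (NCell z (NAdd ze (V aI)))).

Definition ClearBound : cmd := For aI (V aM) (SetN aBound (V aI) 0).

Definition Push (vmi : cmd) : cmd :=
  Seq (SetR rEps 0 (RDiv (RSub (RCell rGap 0) (RCell rMin 0)) (RCell rPow (V aM))))
    (Seq (SetN aK 0 (V aBest))
      (Seq (Solve vmi)
        (Seq (Copy (V aN) aStk (V aStkPos) (sh 4) 0)
          (Seq (Query 0 (sh 4) rVal aFlag)
            (Seq (SetR rStk (V aDepth) (RCell rVal 0))
              (Seq (SetN aDepth 0 (NAdd (V aDepth) 1))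
                (SetN aStkPos 0 (NAdd (V aStkPos) (V aN))))))))).

Definition Pop : cmd :=
  Seq (SetN aDepth 0 (NSub (V aDepth) 1))
    (Seq (SetN aStkPos 0 (NSub (V aStkPos) (V aN)))
      (Seq (Copy (V aN) aSet 0 aStk (V aStkPos))
        (Seq ClearBound
          (Seq (AddLevels aSet aBound)
            (Seq (Copy (V aM) aEta (V aEtaPos) aBound 0)
              (Seq (SetR rOut (V aOut) (RCell rStk (V aDepth)))
                (Seq (SetN aOut 0 (NAdd (V aOut) 1))
                  (SetN aEtaPos 0 (NAdd (V aEtaPos) (V aM)))))))))).

Section Moves.
Variables (R : realType) (vmi : cmd) (T : nat -> nat).
Variables (m : nat) (E : finType) (P : {set {set E}}) (g : {set E} -> R).
Variables (Ei : 'I_m -> {set E}) (part : E -> 'I_m).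
Implicit Types (s S : state R) (outs stk : seq {set E}) (bd : nat -> nat) (X Y Z : {set E}).
Local Notation n := (#|E|).
Local Notation run := (run (fun _ => extend P g)).
Local Notation cl := (fun e => part e : nat).
Local Notation lev := (level cl).
Local Notation q := (n.+1).
Local Notation t := (T (n + n)).

Lemma run_copy bnd d de z ze N o1 o2 s : d != aI -> z != aI -> z != d ->
  (forall s', frame [:: aI; d] [::] s s' -> [/\ neval s' bnd = N, neval s' de = o1 & neval s' ze = o2]) ->
  run (Copy bnd d de z ze) s (3 * N + 2) (fun s' => [/\ frame [:: aI; d] [::] s s',
    forall i, i < N -> nmem s' d (o1 + i) = nmem s z (o2 + i) &
    forall i, i < o1 -> nmem s' d i = nmem s d i]).
Proof.
move=> dI zI zd ev.
apply: (@run_le _ _ _ (N * (1 + 2) + 2)); last by lia.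
pose I k s' := [/\ frame [:: aI; d] [::] s s',
    forall i, i < k -> nmem s' d (o1 + i) = nmem s z (o2 + i) &
    forall i, i < o1 -> nmem s' d i = nmem s d i].
apply: run_post (run_for (I := I) (N := N) (tau := 1) _ _ _) _.
- split=> //; first exact: frame_setn.
  by move=> i _; rewrite nmem_setn (negbTE dI).
- by move=> i s' _ _ [/ev[]].
- move=> k s' kN ek [fr a b]; have [_ e1 e2] := ev s' fr.
  have dI' : (aI == d) = false by rewrite eq_sym (negbTE dI).
  apply: run_setn; split; first by rewrite nmem_setn dI'.
  have -> : neval s' (NAdd de (V aI)) = o1 + k by rewrite -e1 -ek.
  have -> : neval s' (NCell z (NAdd ze (V aI))) = nmem s z (o2 + k).
    rewrite -e2 -ek /= fr.1 //.
    by rewrite !inE negb_or zI zd.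
  split.
  + by do 2!apply: frame_setn => //; rewrite !inE eqxx orbT.
  + move=> i; rewrite !nmem_setn (negbTE dI) eqxx /= eqn_add2l ltnS leq_eqVlt.
    by case: eqVneq => [->|_] //= /a.
  + move=> i io; rewrite !nmem_setn (negbTE dI) eqxx /= b // ltn_eqF //.
    exact: leq_trans io (leq_addr _ _).
- by move=> s' [_ I'].
Qed.

Lemma run_clear_bound s : nmem s aM 0 = m ->
  run ClearBound s (3 * m + 2) (fun s' => frame [:: aI; aBound] [::] s s' /\
    forall c, c < m -> nmem s' aBound c = 0).
Proof.
move=> eM; apply: (@run_le _ _ _ (m * (1 + 2) + 2)); last by lia.
pose I k s' := frame [:: aI; aBound] [::] s s' /\ forall c, c < k -> nmem s' aBound c = 0.
apply: run_post (run_for (I := I) (N := m) (tau := 1) _ _ _) _.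
- by split=> //; apply: frame_setn.
- by move=> i s' _ _ [fr _]; rewrite /= fr.1.
- move=> k s' km ek [fr a]; apply: run_setn; split=> //; split; first by do 2!apply: frame_setn => //.
  move=> c; rewrite !nmem_setn /= ek ltnS leq_eqVlt.
  by case: eqVneq => [->|_] //= /a.
- by move=> s' [_ I'].
Qed.

Lemma base_keep ns rs outs stk bd s s' : keep ns rs s s' ->
  all (fun a => a \notin ns) [:: aN; aM; aPart; aInit] -> rPow \notin rs ->
  store P g part outs stk bd s ->
  [/\ static part s', forall i, i <= m -> rmem s' rPow i = (q ^ i)%:R%R
    & array_set E (nmem s' aInit) \in P].
Proof.
move=> [kn kr] /and5P[h1 h2 h3 h4 _] h5 st; have [e0 e1 e2] := st_static st; split.
- by split; rewrite ?kn // => e; rewrite kn.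
- by move=> i im; rewrite kr // (st_pow st).
- have -> : array_set E (nmem s' aInit) = array_set E (nmem s aInit).
    by apply/setP => e; rewrite !in_array_set kn.
  exact: st_init st.
Qed.

Lemma frame_keep ns rs ns' rs' s s' : frame ns rs s s' -> all (fun a => a \in ns') ns ->
  all (fun a => a \in rs') rs -> keep ns' rs' s s'.
Proof. by move=> fr a b; have [kn kr] := frame_weak fr a b; split=> x i _ h; [apply: kn|apply: kr]. Qed.

Lemma keep_weak ns rs ns' rs' s s' : keep ns rs s s' -> all (fun a => a \in ns') ns ->
  all (fun a => a \in rs') rs -> keep ns' rs' s s'.
Proof.
move=> [kn kr] /allP sn /allP sr.
by split=> a i lt h; [apply: kn|apply: kr] => //; apply: contra h; [apply: sn|apply: sr].
Qed.

Lemma last_lt_all st X : pairwise (fun X Y => (g Y < g X)%R) st ->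
  (st != [::] -> (g X < g (last set0 st))%R) -> all (fun Y => (g X < g Y)%R) st.
Proof.
case/lastP: st => // st Z; rewrite pairwise_rcons all_rcons last_rcons => /andP[/allP lt _] h.
have gX : (g X < g Z)%R by apply: h; rewrite -size_eq0 size_rcons.
by rewrite gX; apply/allP => Y /lt; apply: lt_trans.
Qed.

Definition pushN := [:: aStk; aDepth; aStkPos] ++ scratchN.
Definition pushR := rStk :: scratchR.

Hypothesis solves : solves_VMI R vmi T.
Hypothesis Ei_part : forall i, Ei i = [set e | part e == i].
Hypothesis exP : exchange P g.
Hypothesis m0 : 0 < m.

(** The last clause of [scanned] is exactly what [tilted_pareto] needs. *)
Lemma run_push outs stk bd s : store P g part outs stk bd s -> progress P g Ei part bd outs stk ->
  scanned P g part stk bd m s -> nmem s aImproved 0 != 0 ->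
  run (Push vmi) s (18 * t + 4 * n + 8) (fun s' => nmem s' aRun 0 = nmem s aRun 0 /\
    exists X, store P g part outs (rcons stk X) bd s' /\ progress P g Ei part bd outs (rcons stk X)).
Proof.
move=> st pr sc imp; case: sc => _ _ _ /(_ imp)[_ bm [X0 [X0P X0c gX0]] ltB [minB stkB]].
set k := nmem s aBest 0 in bm X0c minB; set B := rmem s rGap 0 in ltB minB stkB.
have [eN eM eP] := st_static st; have ePow := st_pow st.
apply: (@run_le _ _ _ (1 + (1 + (18 * t + ((3 * n + 2) + (n.+1 + (1 + (1 + 1)))))))); last first.
  by move: (18 * t) => u; move: n; clear; lia.
apply: run_seq; apply: run_setr; apply: run_seq; apply: run_setn.
set s1 := setn _ _ _ _.
have k1 : scratch s s1 by apply: keep_setn => //; apply: keep_setr.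
have st1 := store_keep k1 st.
have ek1 : nmem s1 aK 0 = k by [].
pose eps := ((B - g X0) / (q ^ m)%:R)%R.
have ee1 : rmem s1 rEps 0 = eps.
  by rewrite /eps -ePow // gX0 -eM.
have run1 : nmem s1 aRun 0 = nmem s aRun 0 by [].
clearbody s1.
have bk : 0 < bd k by case/in_cutP: X0c => _; apply: leq_trans.
apply: run_seq; apply: run_post (run_solve solves exP bm (store_ctx st1 ek1 ee1) (st_init st1) _ bk) _.
  by move=> c ck; apply: (st_ref st1 bm bk ck).
move=> s2 [o2 [[_ nf]|[_ [XP Xc opt]]]]; first by have := nf X0 X0P; rewrite X0c.
set X := array_set _ _ in XP Xc opt.
have [ltX parX] : (g X < B)%R /\ pareto_optimal P g Ei X.
  apply: (tilted_pareto Ei_part (a := bd) (k := k) (X0 := X0)) => //; by rewrite gX0.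
have {}pr : progress P g Ei part bd outs (rcons stk X).
  apply: progress_push => //; first by apply/belowP; exists k.
  case: pr => _ _ _ _ sS; apply: last_lt_all => // /stkB; exact: lt_le_trans.
have k2 : scratch s s2 by apply: keep_trans k1 (own_scratch o2).
have st2 := store_keep k2 st.
have [eN2 eM2 eP2] := st_static st2.
apply: run_seq; apply: run_post (run_copy (N := n) (o1 := size stk * n) (o2 := 0) _ _ _ _) _ => //.
  by move=> s' fr; rewrite /= !fr.1 // (st_stkpos st2).
move=> s3 [f3 cp low].
have k3 : keep pushN pushR s2 s3 by apply: frame_keep f3 _ _.
apply: run_seq; apply: run_query; cbv zeta.
have -> : array_set E (nmem s3 (sh 4)) = X.
  by apply/setP => e; rewrite !in_array_set f3.1.
rewrite /extend XP [fine _]/=; set s4 := setn _ _ _ _.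
have k4 : keep pushN pushR s3 s4 by apply: keep_setn => //; apply: keep_setr.
have ed4 : neval s4 (V aDepth) = size stk by rewrite -(st_depth st2); apply: f3.1.
have ep4 : nmem s4 aStkPos 0 = size stk * n by rewrite -(st_stkpos st2); apply: f3.1.
have en4 : nmem s4 aN 0 = n by rewrite -eN2; apply: f3.1.
have ev4 : reval s4 (RCell rVal 0) = g X by [].
have stk4 x : nmem s4 aStk x = nmem s3 aStk x by [].
have rstk4 x : rmem s4 rStk x = rmem s2 rStk x by apply: f3.2.
have run4 : nmem s4 aRun 0 = nmem s aRun 0 by rewrite -run1 -(o2.1 aRun) //; apply: f3.1.
have k04 : keep pushN pushR s s4.
  by apply: keep_trans k4; apply: keep_trans k3; apply: keep_weak k2 _ _.
clearbody s4.
apply: run_seq; apply: run_setr; rewrite ed4 ev4; apply: run_seq; apply: run_setn; apply: run_setn.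
set s5 := setn _ _ _ _.
have k5 : keep pushN pushR s s5.
  by apply: keep_setn => //; apply: keep_setn => //; apply: keep_setr.
have [kn kr] := k5.
split; first exact: run4.
have [hb1 hb2 hb3] := base_keep k5 isT isT st.
exists X; split=> //; split=> //.
- by move=> c cm; rewrite kn // (st_bound st).
- have -> : array_set E (nmem s5 aSet) = array_set E (nmem s aSet).
    by apply/setP => e; rewrite !in_array_set kn.
  exact: st_ref st.
- by rewrite kn // (st_out st).
- by rewrite kn // (st_etapos st).
- move=> j js; have [h1 h2] := st_outs st js.
  by rewrite kr //; split=> // i im; rewrite kn // h2.
- have -> : nmem s5 aDepth 0 = (nmem s4 aDepth 0) + 1 by [].
  by rewrite -[nmem s4 aDepth 0]/(neval s4 (V aDepth)) ed4 size_rcons addn1.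
- have -> : nmem s5 aStkPos 0 = (nmem s4 aStkPos 0) + nmem s4 aN 0 by [].
  by rewrite ep4 en4 size_rcons mulSn addnC.
- have e5 x : nmem s5 aStk x = nmem s3 aStk x by rewrite -stk4.
  have r5 x : rmem s5 rStk x = if x == size stk then g X else rmem s2 rStk x by rewrite -rstk4.
  move=> j; rewrite size_rcons ltnS leq_eqVlt r5 nth_rcons => /orP[/eqP ->|js].
    rewrite ltnn eqxx; split=> // e; rewrite e5 cp ?rank_lt //.
    by rewrite in_array_set.
  rewrite js (ltn_eqF js); have [h1 h2] := st_stk st2 js; split=> // e.
  rewrite e5 low ?h2 //; apply: (@leq_trans (j.+1 * n)); last by rewrite leq_mul2r js orbT.
  by rewrite mulSn addnC ltn_add2r rank_lt.
Qed.

Definition popN := [:: aI; aDepth; aStkPos; aSet; aBound; aEta; aOut; aEtaPos].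
Definition popR := [:: rOut].

Lemma run_pop outs stk Z bd s : store P g part outs (rcons stk Z) bd s ->
  run Pop s (6 * n + 6 * m + 13) (fun s' => nmem s' aRun 0 = nmem s aRun 0 /\
    store P g part (rcons outs Z) stk (lev^~ Z) s').
Proof.
move=> st; have [eN eM eP] := st_static st.
apply: (@run_le _ _ _ (1 + (1 + ((3 * n + 2) + ((3 * m + 2) + ((3 * n + 2) + ((3 * m + 2) + (1 + (1 + 1))))))))); last first.
  by move: n m; clear; lia.
apply: run_seq; apply: run_setn; apply: run_seq; apply: run_setn.
set s1 := setn _ _ _ _.
have k1' : keep [:: aDepth; aStkPos] [::] s s1 by do 2!apply: keep_setn => //.
have ed1 : nmem s1 aDepth 0 = size stk.
  have -> : nmem s1 aDepth 0 = nmem s aDepth 0 - 1 by [].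
  by rewrite (st_depth st) size_rcons subn1.
have ep1 : nmem s1 aStkPos 0 = size stk * n.
  have -> : nmem s1 aStkPos 0 = nmem s aStkPos 0 - nmem s aN 0 by [].
  by rewrite (st_stkpos st) eN size_rcons mulSn addKn.
clearbody s1; have [kn1 kr1] := k1'.
have k1 : keep popN popR s s1 by apply: keep_weak k1' _ _.
apply: run_seq; apply: run_post (run_copy (N := n) (o1 := 0) (o2 := size stk * n) _ _ _ _) _ => //.
  by move=> s' fr; rewrite /= !fr.1 // kn1.
move=> s2 [f2 cp2 _].
have k2 : keep popN popR s s2 by apply: keep_trans k1 _; apply: frame_keep f2 _ _.
have [hs2 _ _] := base_keep k2 isT isT st.
have [eN2 eM2 eP2] := hs2.
apply: run_seq; apply: run_post (run_clear_bound eM2) _ => s3 [f3 cl3].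
have k3 : keep popN popR s s3 by apply: keep_trans k2 _; apply: frame_keep f3 _ _.
have [hs3 _ _] := base_keep k3 isT isT st.
apply: run_seq; apply: run_post (run_add_levels _ _ _ _ _ _ hs3) _ => // s4 [f4 cl4].
have k4 : keep popN popR s s4 by apply: keep_trans k3 _; apply: frame_keep f4 _ _.
have [eN4 eM4 eP4] : static part s4 by have [] := base_keep k4 isT isT st.
have eta4 : nmem s4 aEtaPos 0 = size outs * m.
  by rewrite f4.1 // f3.1 // f2.1 // kn1 // (st_etapos st).
apply: run_seq; apply: run_post (run_copy (N := m) (o1 := size outs * m) (o2 := 0) _ _ _ _) _ => //.
  by move=> s' fr; rewrite /= !fr.1.
move=> s5 [f5 cp5 low5].
have k5 : keep popN popR s s5 by apply: keep_trans k4 _; apply: frame_keep f5 _ _.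
have eZ3 : array_set E (nmem s3 aSet) = Z.
  apply/setP => e; rewrite in_array_set f3.1 // -[X in nmem s2 _ X]add0n cp2 ?rank_lt // kn1 //.
  have [|_ ->] := st_stk st (j := size stk); first by rewrite size_rcons.
  by rewrite nth_rcons ltnn eqxx.
have lev4 c : c < m -> nmem s4 aBound c = lev c Z.
  by move=> cm; rewrite cl4 cl3 // eZ3.
have out5 : nmem s5 aOut 0 = size outs.
  by rewrite f5.1 // f4.1 // f3.1 // f2.1 // kn1 // (st_out st).
have d5 : nmem s5 aDepth 0 = size stk by rewrite f5.1 // f4.1 // f3.1 // f2.1.
have ep5 : nmem s5 aStkPos 0 = size stk * n by rewrite f5.1 // f4.1 // f3.1 // f2.1.
have eta5 : nmem s5 aEtaPos 0 = size outs * m by rewrite f5.1.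
have [eN5 eM5 eP5] : static part s5 by have [] := base_keep k5 isT isT st.
have run5 : nmem s5 aRun 0 = nmem s aRun 0 by apply: k5.1.
have stk5 x : nmem s5 aStk x = nmem s aStk x by apply: k5.1.
have rstk5 x : rmem s5 rStk x = rmem s rStk x by apply: k5.2.
have set5 : array_set E (nmem s5 aSet) = Z.
  by rewrite -eZ3; apply/setP => e; rewrite !in_array_set f5.1 // f4.1.
have bd5 c : c < m -> nmem s5 aBound c = lev c Z by move=> cm; rewrite f5.1 // lev4.
have eta_low x : x < size outs * m -> nmem s5 aEta x = nmem s aEta x.
  by move=> lt; rewrite low5 // f4.1 // f3.1 // f2.1 // kn1.
have out_low x : rmem s5 rOut x = rmem s rOut x.
  by rewrite f5.2 // f4.2 // f3.2 // f2.2 // kr1.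
have rd5 : reval s5 (RCell rStk (V aDepth)) = g Z.
  rewrite -[LHS]/(rmem s5 rStk (nmem s5 aDepth 0)) d5 rstk5.
  have [|-> _] := st_stk st (j := size stk); first by rewrite size_rcons.
  by rewrite nth_rcons ltnn eqxx.
apply: run_seq; apply: run_setr; apply: run_seq; apply: run_setn; apply: run_setn.
rewrite rd5 -[neval s5 (V aOut)]/(nmem s5 aOut 0) out5; set s6 := setn _ _ _ _.
have k6 : keep popN popR s s6.
  by do 2!apply: keep_setn => //; apply: keep_setr.
have [hb1 hb2 hb3] := base_keep k6 isT isT st.
split; first exact: run5.
split=> //.
- have -> : array_set E (nmem s6 aSet) = array_set E (nmem s5 aSet) by [].
  by rewrite set5.
- have -> : nmem s6 aOut 0 = nmem s5 aOut 0 + 1 by [].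
  by rewrite out5 size_rcons addn1.
- have -> : nmem s6 aEtaPos 0 = nmem s5 aEtaPos 0 + nmem s5 aM 0 by [].
  by rewrite eta5 eM5 size_rcons mulSn addnC.
- have e6 x : nmem s6 aEta x = nmem s5 aEta x by [].
  have r6 x : rmem s6 rOut x = if x == size outs then g Z else rmem s5 rOut x by [].
  move=> j; rewrite size_rcons ltnS leq_eqVlt r6 nth_rcons => /orP[/eqP ->|js].
    by rewrite ltnn eqxx; split=> // i im; rewrite e6 cp5 // add0n lev4.
  rewrite js (ltn_eqF js); have [h1 h2] := st_outs st js; rewrite out_low; split=> // i im.
  rewrite e6 eta_low ?h2 //; apply: (@leq_trans (j.+1 * m)); last by rewrite leq_mul2r js orbT.
  by rewrite mulSn addnC ltn_add2r.
- move=> j js; have js' : j < size (rcons stk Z) by rewrite size_rcons ltnS ltnW.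
  have [h1 h2] := st_stk st js'; rewrite nth_rcons js in h1 h2.
  have e6 x : nmem s6 aStk x = nmem s aStk x by rewrite -stk5.
  have r6 x : rmem s6 rStk x = rmem s rStk x by rewrite -rstk5.
  by rewrite r6; split=> // e; rewrite e6.
Qed.

End Moves.

(** * The enumeration program *)

Definition Powers : cmd :=
  For aI (V aM)
    (SetR rPow (NAdd (V aI) 1) (RMul (RCell rPow (V aI)) (ROfNat (NAdd (V aN) 1)))).

Definition Init : cmd :=
  Seq (SetN aOut 0 0)
    (Seq (SetN aEtaPos 0 0)
      (Seq (SetN aDepth 0 0)
        (Seq (SetN aStkPos 0 0)
          (Seq ClearBound
            (Seq (SetN aBound 0 (NAdd (V aN) 1))
              (Seq (SetR rPow 0 (ROfNat 1))
                (Seq Powers (SetN aRun 0 1)))))))).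

Definition Iteration (vmi : cmd) : cmd :=
  Seq (Scan vmi)
    (If (TLeN (V aImproved) 0)
      (If (TLeN (V aDepth) 0) (SetN aRun 0 0) Pop)
      (Push vmi)).

Definition Enumerate (vmi : cmd) : cmd :=
  Seq Init (While (TNot (TLeN (V aRun) 0)) (Iteration vmi)).

Section Enumeration.
Variables (R : realType) (vmi : cmd) (T : nat -> nat).
Hypothesis solves : solves_VMI R vmi T.
Variables (m : nat) (E : finType) (P : {set {set E}}) (g : {set E} -> R).
Variables (Ei : 'I_m -> {set E}) (part : E -> 'I_m).
Hypothesis Ei_part : forall i, Ei i = [set e | part e == i].
Hypothesis exP : exchange P g.
Hypothesis m0 : 0 < m.
Implicit Types (s S : state R) (outs stk : seq {set E}) (bd : nat -> nat) (X Y Z : {set E}).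
Local Notation n := (#|E|).
Local Notation run := (run (fun _ => extend P g)).
Local Notation cl := (fun e => part e : nat).
Local Notation lev := (level cl).
Local Notation q := (n.+1).
Local Notation t := (T (n + n)).

Lemma run_init s : enum_input P Ei s ->
  run Init s (6 * m + 12) (fun s' => nmem s' aRun 0 = 1 /\
    store P g part [::] [::] (top_bound E) s').
Proof.
move=> [eN eM eP eI].
apply: (@run_le _ _ _ (1 + (1 + (1 + (1 + ((3 * m + 2) + (1 + (1 + (m * (1 + 2) + 2 + 1)))))))));
  last by move: m; clear; lia.
do 4!(apply: run_seq; apply: run_setn); set s1 := setn _ _ _ _.
have eM1 : nmem s1 aM 0 = m by [].
have k1 : keep popN popR s s1 by do 4!apply: keep_setn => //.
have [o1 [e1 [d1 p1]]] : nmem s1 aOut 0 = 0 /\ nmem s1 aEtaPos 0 = 0 /\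
  nmem s1 aDepth 0 = 0 /\ nmem s1 aStkPos 0 = 0 by [].
clearbody s1.
apply: run_seq; apply: run_post (run_clear_bound P g eM1) _ => s2 [f2 c2].
have k2 : keep popN popR s s2 by apply: keep_trans k1 _; apply: frame_keep f2 _ _.
apply: run_seq; apply: run_setn; apply: run_seq; apply: run_setr; set s3 := setr _ _ _ _.
have bd3 c : c < m -> nmem s3 aBound c = top_bound E c.
  move=> cm; rewrite /top_bound -eN -(k2.1 aN) //.
  by rewrite /s3 nmem_setr nmem_setn /= addn1; case: eqP => // _; apply: c2.
have k3 : keep popN (rPow :: popR) s s3.
  by apply: keep_setr => //; apply: keep_setn => //; apply: keep_weak k2 _ _.
have p3 : rmem s3 rPow 0 = (q ^ 0)%:R%R by [].
have [o3 [e3 [d3 q3]]] : nmem s3 aOut 0 = 0 /\ nmem s3 aEtaPos 0 = 0 /\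
  nmem s3 aDepth 0 = 0 /\ nmem s3 aStkPos 0 = 0.
  by rewrite -(f2.1 aOut) // in o1; rewrite -(f2.1 aEtaPos) // in e1;
     rewrite -(f2.1 aDepth) // in d1; rewrite -(f2.1 aStkPos) // in p1.
clearbody s3.
pose I k s' := frame [:: aI] [:: rPow] s3 s' /\ forall i, i <= k -> rmem s' rPow i = (q ^ i)%:R%R.
apply: run_seq; apply: run_post (run_for (I := I) (N := m) (tau := 1) _ _ _) _.
- by split=> [|i]; [apply: frame_setn|rewrite leqn0 => /eqP->].
- by move=> i s' _ _ [fr _]; rewrite /= fr.1 // k3.1.
- move=> k s' km ek [fr a]; apply: run_setr; split=> //; split.
    by apply: frame_setn => //; apply: frame_setr.
  move=> i; rewrite rmem_setn rmem_setr /= ek addn1 leq_eqVlt ltnS.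
  case: eqVneq => [->|_] //= ik; last exact: a.
  by rewrite a // fr.1 // k3.1 // eN addn1 -natrM expnSr.
move=> s4 [_ [f4 a4]].
apply: run_setn; split=> //.
have kn a i : a < 24 -> a != aRun -> a != aI -> nmem (setn s4 aRun 0 1) a i = nmem s3 a i.
  by move=> lt nr ni; rewrite nmem_setn (negbTE nr) f4.1 // inE.
split=> //; rewrite ?kn //.
- split; rewrite ?kn ?k3.1 //.
  by move=> e; rewrite kn // k3.1 //; apply: eP; rewrite Ei_part inE.
- have -> : array_set E (nmem (setn s4 aRun 0 1) aInit) = array_set E (nmem s aInit).
    by apply/setP => e; rewrite !in_array_set kn // k3.1.
  exact: eI.
- by move=> c cm; rewrite kn // bd3.
- by move=> k c _; rewrite /top_bound; case: k.
Qed.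

Lemma store_output outs stk bd s : store P g part outs stk bd s ->
  enum_output m s = map (value g Ei) outs.
Proof.
move=> st; rewrite /enum_output (st_out st) -[in RHS](mkseq_nth set0 outs) /mkseq -map_comp.
apply/eq_in_map => j; rewrite mem_iota /= => js; have [h1 h2] := st_outs st js.
rewrite h1 /value; congr pair; apply/ffunP => i.
by rewrite (eta_level Ei_part) ffunE h2.
Qed.

(** A push adds one to the size of stk; a pop adds one to that of outs and removes
    one from that of stk.  Counting outs twice makes both progress by one. *)
Definition loop_state M s : Prop :=
  (nmem s aRun 0 = 1 /\ exists outs stk bd,
     [/\ store P g part outs stk bd s, progress P g Ei part bd outs stk
       & M = (2 * num_pareto_values P g Ei).+1 - (2 * size outs + size stk)]) \/
  [/\ nmem s aRun 0 = 0, M = 0 & perm_eq (enum_output m s) (pareto_values P g Ei)].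

Lemma run_iteration M s : loop_state M s -> teval s (TNot (TLeN (V aRun) 0)) ->
  run (Iteration vmi) s (m * (18 * t + n + 13) + 8 + (18 * t + 6 * n + 6 * m + 15))
    (fun s' => exists2 M', M' < M & loop_state M' s').
Proof.
case=> [[r1 [outs [stk [bd [st pr eM]]]]]|[r0 _ _]]; last by rewrite [teval _ _]/= r0.
move=> _; apply: run_seq; apply: run_post (run_scan solves exP st) _ => s1 [k1 sc1].
have st1 := store_keep k1 st.
have r11 : nmem s1 aRun 0 = 1 by rewrite k1.1.
have pN := progress_size Ei_part pr.
apply: (@run_le _ _ _ (18 * t + 6 * n + 6 * m + 14).+1); last by rewrite (addnS _ 14).
apply: run_if; rewrite [teval _ _]/= leqn0; case: eqP => im; last first.
  apply: (@run_le _ _ _ (18 * t + 4 * n + 8)).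
    apply: run_post (run_push solves Ei_part exP st1 pr sc1 _) _; first exact/eqP.
    move=> s2 [r2 [X [st2 pr2]]]; have := progress_size Ei_part pr2; rewrite size_rcons => pN2.
    exists ((2 * num_pareto_values P g Ei).+1 - (2 * size outs + (size stk).+1)).
      by rewrite eM; move: pN pN2; move: (size _) (size _) (num_pareto_values _ _ _); clear; lia.
    left; split; first by rewrite r2.
    by exists outs, (rcons stk X), bd; split=> //; rewrite size_rcons.
  by move: (18 * t) n m; clear; lia.
apply: (@run_le _ _ _ (18 * t + 6 * n + 6 * m + 13).+1); last by rewrite (addnS _ 13).
case: sc1 => a b c _; have {}c := c im.
have all_below f : (nmem s1 aFound 0 != 0 -> f) -> forall Y, Y \in P -> below part bd Y ->
   f /\ (rmem s1 rMin 0 <= g Y)%R.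
  by move=> hf Y YP /belowP[k km /(a k Y km YP)[/hf]].
apply: run_if; rewrite [teval _ _]/= (st_depth st1) leqn0 size_eq0.
have [s0|sn0] := eqVneq stk [::].
  apply: run_le (_ : 1 <= _); last by rewrite addnS.
  apply: run_setn; exists 0.
    by rewrite eM; move: pN; move: (size _) (size _) (num_pareto_values _ _ _); clear; lia.
  right; split=> //; rewrite -[enum_output _ _]/(enum_output m s1) (store_output st1).
  rewrite s0 in pr; apply: (progress_end pr) => Y YP.
  by apply/negP => bY; have [] := all_below false _ Y YP bY; first by move=> /c[]; rewrite s0.
have [stk' [Z es]] : exists st' Z, stk = rcons st' Z.
  by case/lastP: (stk) sn0 => // st' Z _; exists st', Z.
subst stk; apply: (@run_le _ _ _ (6 * n + 6 * m + 13)); last first.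
  by move: (18 * t) n m; clear; lia.
apply: run_post (run_pop st1) _ => s2 [r2 st2].
have minZ Y : Y \in P -> below part bd Y -> (g Z <= g Y)%R.
  move=> YP bY; have [_] := all_below true (fun _ => isT) Y YP bY.
  have [fnd _] := b sn0; have [_ ->] := c fnd; by rewrite last_rcons.
have pr2 := progress_pop Ei_part pr minZ; have := progress_size Ei_part pr2.
move: pN eM; rewrite !size_rcons => pN eM pN2.
exists ((2 * num_pareto_values P g Ei).+1 - (2 * (size outs).+1 + size stk')).
  by rewrite eM; move: pN pN2; move: (size _) (size _) (num_pareto_values _ _ _); clear; lia.
left; split; first by rewrite r2.
by exists (rcons outs Z), stk', (lev^~ Z); split=> //; rewrite size_rcons.
Qed.

(** The first round of the enumeration already produces a Pareto optimal set.  This is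
    needed because the initialization must be paid by P times the time of a call. *)
Lemma num_pareto_gt0 : P != set0 -> 0 < num_pareto_values P g Ei.
Proof.
case/set0Pn => X0 X0P.
case: (@arg_minP _ R _ X0 (fun X => X \in P) g X0P) => X1 X1P min1.
pose eps := ((g X1 + 1 - g X1) / (q ^ m)%:R)%R.
case: (@arg_minP _ R _ X1 (fun X => X \in P) (tilted g part eps) X1P) => X XP minX.
have top Y : in_cut cl 0 (top_bound E) Y.
  by apply/in_cutP; split=> //; rewrite /top_bound eqxx ltnS level_card.
have [_ pX] : (g X < g X1 + 1)%R /\ pareto_optimal P g Ei X.
  apply: (tilted_pareto Ei_part (a := top_bound E) (k := 0) (X0 := X1)) => //.
    by rewrite ltrDl.
  by move=> Y YP _; apply: minX.
rewrite /num_pareto_values lt0n size_eq0; apply: contraTneq isT => e0.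
have : value g Ei X \in pareto_values P g Ei by rewrite mem_undup; apply/imageP; exists X.
by rewrite e0.
Qed.

Lemma enumerate_correct : P != set0 ->
  enumerates (Enumerate vmi) P g Ei (300 * (m * num_pareto_values P g Ei * T (2 * #|E|))).
Proof.
move=> P0 s inp.
suff [s' [u [ex le q]]] : run (Enumerate vmi) s
    (300 * (m * num_pareto_values P g Ei * T (2 * #|E|)))
    (fun s' => perm_eq (enum_output m s') (pareto_values P g Ei)) by exists s', u.
have N0 := num_pareto_gt0 P0; set N := num_pareto_values _ _ _ in N0 *.
rewrite mul2n -addnn; pose tau := m * (18 * t + n + 13) + 8 + (18 * t + 6 * n + 6 * m + 15).
apply: (@run_le _ _ _ (6 * m + 12 + ((2 * N).+1 * tau.+1).+1)).
  apply: run_seq; apply: run_post (run_init inp) _ => s1 [r1 st1].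
  apply: run_post (@run_while _ _ _ loop_state _ _ tau _ ((2 * N).+1) s1 _) _.
  - by move=> M s2 Ls; apply: run_iteration.
  - left; split=> //; exists [::], [::], (top_bound E); split=> //.
    exact: progress_init.
  - move=> s2 [stop [M [[r2 _]|[_ _ //]]]]; by move: stop; rewrite [teval _ _]/= r2.
have u1 : m * n <= m * t by rewrite leq_mul2l ltnW ?orbT // (card_lt_time solves).
have t0 : n < t := card_lt_time solves E.
have u2 : m <= m * t by rewrite leq_pmulr // (leq_trans _ t0).
have u3 : t <= m * t by rewrite leq_pmull.
have tauE : tau.+1 <= 86 * (m * t).
  have e : m * (18 * t + n + 13) = 18 * (m * t) + m * n + 13 * m.
    by move: (t) n m; clear; lia.
  by rewrite /tau e; move: u1 u2 u3 t0 m0; move: (m * t) (m * n) (t) n m; clear; lia.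
apply: (@leq_trans (6 * m + 12 + ((2 * N).+1 * (86 * (m * t))).+1)).
  by rewrite leq_add2l ltnS leq_mul2l tauE orbT.
have e : m * N * t = N * (m * t) by rewrite mulnAC mulnC.
rewrite e; have u4 : m * t <= N * (m * t) by rewrite leq_pmull.
have -> : (2 * N).+1 * (86 * (m * t)) = 172 * (N * (m * t)) + 86 * (m * t).
  by clearbody N; clear; move: (m * t) => u; lia.
move: u1 u2 u3 u4 t0 m0.
by move: (N * (m * t)) (m * t) (m * n) (t) n m; clear; lia.
Qed.

End Enumeration.

(** * Bounds on the number of Pareto optimal values *)

Lemma partition_part m (E : finType) (Ei : 'I_m -> {set E}) : partition_into Ei ->
  exists part : E -> 'I_m, forall i, Ei i = [set e | part e == i].
Proof.
move=> [cov dis].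
have ex e : exists i, e \in Ei i.
  have : e \in \bigcup_i Ei i by rewrite cov inE.
  by case/bigcupP => i _ ei; exists i.
exists (fun e => xchoose (ex e)) => i; apply/setP => e; rewrite inE.
have eP := xchooseP (ex e); set j := xchoose _ in eP *.
apply/idP/eqP => [ei|<- //]; apply/eqP; apply: contraTT eP => ji.
have := dis i j; rewrite eq_sym => /(_ ji); rewrite disjoint_subset => /subsetP/(_ e ei).
by rewrite inE.
Qed.

(** Two Pareto optimal sets with the same eta have the same value, and a vector of m
    naturals of sum at most r is a partial ordered partition of r. *)
Lemma num_pareto_bound (R : realType) m (E : finType) (P : {set {set E}}) (g : {set E} -> R)
    (Ei : 'I_m -> {set E}) : partition_into Ei ->
  num_pareto_values P g Ei <= 'C(largest_card P + m, m).
Proof.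
case/partition_part => part Ei_part; set r := largest_card P.
pose f (v : R * {ffun 'I_m -> int}) : m.-tuple 'I_r.+1 := [tuple inord `|v.2 i|%N | i < m].
have lev_r X i : X \in P -> level (fun e => part e : nat) i X <= r.
  move=> XP; apply: leq_trans (leq_bigmax_cond _ XP).
  by apply/subset_leq_card/subsetP => e; rewrite inE => /andP[].
have fE X i : X \in P -> tnth (f (value g Ei X)) i = level (fun e => part e : nat) i X :> nat.
  by move=> XP; rewrite tnth_mktuple /= (eta_level Ei_part) absz_nat inordK // ltnS lev_r.
rewrite addnC -card_partial_ord_partitions cardE /num_pareto_values -(size_map f).
have pv v : v \in pareto_values P g Ei -> exists2 X, pareto_optimal P g Ei X & v = value g Ei X.
  by rewrite mem_undup => /imageP[X pX ->]; exists X.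
apply: uniq_leq_size.
  rewrite map_inj_in_uniq ?undup_uniq // => v w /pv[X pX ->] /pv[Y pY ->] eXY.
  have [/andP[XP _] /andP[YP _]] := (pX, pY).
  apply: (pareto_value_eta Ei_part pX pY); apply/ffunP => i; rewrite !(eta_level Ei_part).
  by rewrite -(fE X) // -(fE Y) // eXY.
move=> u /mapP[v /pv[X /andP[XP _] ->] ->]; rewrite mem_enum inE.
rewrite big_tuple (eq_bigr (fun i : 'I_m => level (fun e => part e : nat) i X)); last first.
  by move=> i _; rewrite fE.
apply: leq_trans (leq_bigmax_cond _ XP); rewrite -[leqRHS]sum1_card.
rewrite (partition_big part xpredT) //=; apply: leq_sum => i _.
by rewrite /level -sum1_card (eq_bigl (fun e => (e \in X) && (part e == i))) // => e; rewrite inE.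
Qed.

Lemma bin_le_expn r m : 'C(r + m, m) <= (r + m) ^ m.
Proof.
apply: leq_trans (leq_pmulr _ (fact_gt0 m)) _; rewrite bin_ffact.
move: (r + m) => x; elim: m x => [|m IH] x; first by rewrite ffactn0.
rewrite ffactnS expnS leq_mul2l; apply/orP; right.
by apply: leq_trans (IH _) _; case: m {IH} => // m; rewrite leq_exp2r // leq_pred.
Qed.

Lemma bin_polynomial m r : 0 < r -> 'C(r + m, m) <= m.+1 ^ m * r ^ m.
Proof.
move=> r0; apply: leq_trans (bin_le_expn r m) _; rewrite -expnMn.
case: m => [|m]; first by rewrite !expn0.
by rewrite leq_exp2r // mulSn leq_add2l leq_pmulr.
Qed.

Theorem mainTheorem3 (R : realType) :
  (exists C c : nat,
    forall (vmi : cmd) (T : nat -> nat), solves_VMI R vmi T ->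
    exists enum : cmd,
      (forall (m : nat) (E : finType) (P : {set {set E}}) (g : {set E} -> R)
          (Ei : 'I_m -> {set E}),
        0 < m -> g_matroid P -> Mnat_convex P g -> partition_into Ei ->
        enumerates enum P g Ei
          (C * (m * num_pareto_values P g Ei * T (c * #|E|)))) /\
      (polynomially_bounded T ->
        forall m : nat, 0 < m ->
        exists d : nat,
        forall (E : finType) (P : {set {set E}}) (g : {set E} -> R)
            (Ei : 'I_m -> {set E}),
          g_matroid P -> Mnat_convex P g -> partition_into Ei ->
          enumerates enum P g Ei (d * #|E|.+1 ^ d))) /\
  (forall (m : nat) (E : finType) (P : {set {set E}}) (g : {set E} -> R)
      (Ei : 'I_m -> {set E}),
    g_matroid P -> Mnat_convex P g -> partition_into Ei ->
    num_pareto_values P g Ei <= 'C(largest_card P + m, m)) /\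
  (forall m : nat, exists D : nat, forall r : nat,
    0 < r -> 'C(r + m, m) <= D * r ^ m).
Proof.
split; last split.
- exists 300, 2 => vmi T solves; exists (Enumerate vmi).
  have main m (E : finType) (P : {set {set E}}) (g : {set E} -> R) (Ei : 'I_m -> {set E}) :
      0 < m -> g_matroid P -> Mnat_convex P g -> partition_into Ei ->
      enumerates (Enumerate vmi) P g Ei (300 * (m * num_pareto_values P g Ei * T (2 * #|E|))).
    move=> m0 [P0 _] /Mnat_exchange exP /partition_part[part Ei_part].
    exact: (enumerate_correct solves Ei_part exP m0 P0).
  split=> // -[d Td] m m0.
  pose K := 300 * (m * m.+1 ^ m * (d * 2 ^ d)).
  exists (K + (m + d)) => E P g Ei gP gM gE s inp.
  have [s' [t [ex le pe]]] := main m E P g Ei m0 gP gM gE s inp.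
  exists s', t; split=> //; apply: leq_trans le _.
  set n := #|E|.
  have le1 : num_pareto_values P g Ei <= m.+1 ^ m * n.+1 ^ m.
    apply: leq_trans (num_pareto_bound P g gE) _.
    apply: leq_trans (_ : 'C(n.+1 + m, m) <= _); last exact: bin_polynomial.
    apply: leq_bin2l; rewrite leq_add2r; apply: leqW.
    by apply/bigmax_leqP => X _; apply: max_card.
  have le2 : T (2 * n) <= d * 2 ^ d * n.+1 ^ d.
    apply: leq_trans (Td _) _; rewrite -mulnA leq_mul2l -expnMn; apply/orP; right.
    case: (d) => [|d']; first by rewrite !expn0.
    by rewrite leq_exp2r // mulnS; apply: leqnSn.
  apply: (@leq_trans (K * n.+1 ^ (m + d))); last first.
    apply: leq_mul; first exact: leq_addr.
    by rewrite leq_pexp2l // leq_addl.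
  rewrite /K -[leqRHS]mulnA leq_mul2l /= -[leqLHS]mulnA.
  apply: leq_trans (leq_mul (leqnn m) (leq_mul le1 le2)) _.
  by rewrite expnD mulnACA !mulnA.
- by move=> m E P g Ei _ _ gE; apply: num_pareto_bound.
- by move=> m; exists (m.+1 ^ m) => r; apply: bin_polynomial.
Qed.
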